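(* In the setting described in the context, let $\mathbf{L}_t$ be the subspace basis produced by the O-LSD iteration at time $t$. Then $g_t(\mathbf{L}_t)-f_t(\mathbf{L}_t)$ converges to $0$ almost surely as $t\to\infty$.
   Context: Fix integers $p,r\ge 1$ and constants $\lambda_1,\lambda_2>0$. Let $\mathcal{G}$ be a finite collection of subsets of $\{1,\dots,p\}$. For $\mathbf{s}\in\mathbb{R}^p$ and $g\in\mathcal{G}$, let $\mathbf{s}_{|g}$ be the vector equal to $\mathbf{s}$ on indices in $g$ and zero elsewhere, and $\|\mathbf{s}\|_{\ell_1/\ell_\infty}=\sum_{g\in\mathcal{G}}\|\mathbf{s}_{|g}\|_\infty$. Define $\hat\ell(\mathbf{d},\mathbf{L},\mathbf{r},\mathbf{s})=\tfrac12\|\mathbf{d}-\mathbf{L}\mathbf{r}-\mathbf{s}\|_2^2+\tfrac{\lambda_1}{2}\|\mathbf{r}\|_2^2+\lambda_2\|\mathbf{s}\|_{\ell_1/\ell_\infty}$ and $\ell(\mathbf{d},\mathbf{L})=\min_{\mathbf{r},\mathbf{s}}\hat\ell(\mathbf{d},\mathbf{L},\mathbf{r},\mathbf{s})$. Data assumption: $\mathbf{d}_1,\mathbf{d}_2,\dots\in\mathbb{R}^p$ are independent random vectors with a common distribution, uniformly bounded (there is $M$ with $\|\mathbf{d}_t\|_2\le M$ for all $t$). O-LSD iteration: arbitrary $\mathbf{L}_0\in\mathbb{R}^{p\times r}$, $\mathbf{A}_0=\mathbf{0}$, $\mathbf{B}_0=\mathbf{0}$. For $t\ge1$: $(\mathbf{r}_t,\mathbf{s}_t)$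 is a minimizer of $\hat\ell(\mathbf{d}_t,\mathbf{L}_{t-1},\cdot,\cdot)$; $\mathbf{A}_t=\mathbf{A}_{t-1}+\mathbf{r}_t\mathbf{r}_t^T$, $\mathbf{B}_t=\mathbf{B}_{t-1}+(\mathbf{d}_t-\mathbf{s}_t)\mathbf{r}_t^T$; $\mathbf{L}_t$ is the minimizer of the surrogate function $g_t(\mathbf{L})=\frac1t\sum_{i=1}^t\hat\ell(\mathbf{d}_i,\mathbf{L},\mathbf{r}_i,\mathbf{s}_i)+\frac{\lambda_1}{2t}\|\mathbf{L}\|_F^2$, i.e. $\mathbf{L}_t=\mathbf{B}_t(\mathbf{A}_t+\lambda_1\mathbf{I})^{-1}$. Empirical cost function: $f_t(\mathbf{L})=\frac1t\sum_{i=1}^t\ell(\mathbf{d}_i,\mathbf{L})+\frac{\lambda_1}{2t}\|\mathbf{L}\|_F^2$. *)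

(* Defs.v *)
From HB Require Import structures.
From mathcomp Require Import all_boot all_order all_algebra.
From mathcomp Require Import all_classical all_reals all_analysis.
Set Implicit Arguments. Unset Strict Implicit. Unset Printing Implicit Defensive.
Import Order.TTheory GRing.Theory Num.Theory.
Import numFieldNormedType.Exports.
Local Open Scope classical_set_scope.
Local Open Scope ring_scope.

Section OLSD.
Variables (R : realType) (p r : nat).

Definition l2sq {n : nat} (v : 'cV[R]_n) : R := \sum_(i < n) (v i 0) ^+ 2.
Definition l2 {n : nat} (v : 'cV[R]_n) : R := Num.sqrt (l2sq v).
Definition frob2 (L : 'M[R]_(p, r)) : R := \sum_(i < p) \sum_(j < r) (L i j) ^+ 2.

Definition linf_restr (s : 'cV[R]_p) (g : {set 'I_p}) : R :=
  \big[Num.max/0]_(i in g) `|s i 0|.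
Definition grpnorm (G : {set {set 'I_p}}) (s : 'cV[R]_p) : R :=
  \sum_(g in G) linf_restr s g.

Definition lhat (G : {set {set 'I_p}}) (lam1 lam2 : R)
  (d : 'cV[R]_p) (L : 'M[R]_(p, r)) (x : 'cV[R]_r) (s : 'cV[R]_p) : R :=
  2^-1 * l2sq (d - L *m x - s) + lam1 / 2 * l2sq x + lam2 * grpnorm G s.

(* ell(d, L) = min over (r, s) of \hat ell (written as the infimum of the values) *)
Definition ell (G : {set {set 'I_p}}) (lam1 lam2 : R)
  (d : 'cV[R]_p) (L : 'M[R]_(p, r)) : R :=
  inf (range (fun xs : 'cV[R]_r * 'cV[R]_p => lhat G lam1 lam2 d L xs.1 xs.2)).

Definition is_minimizer (G : {set {set 'I_p}}) (lam1 lam2 : R)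
  (d : 'cV[R]_p) (L : 'M[R]_(p, r)) (x : 'cV[R]_r) (s : 'cV[R]_p) : Prop :=
  forall (x' : 'cV[R]_r) (s' : 'cV[R]_p),
    lhat G lam1 lam2 d L x s <= lhat G lam1 lam2 d L x' s'.

(* 0-based indexing: the paper's d_t, r_t, s_t are d (t-1), x (t-1), s (t-1). *)
Definition Amat (x : nat -> 'cV[R]_r) (t : nat) : 'M[R]_r :=
  \sum_(i < t) (x i *m (x i)^T).
Definition Bmat (d : nat -> 'cV[R]_p) (x : nat -> 'cV[R]_r) (s : nat -> 'cV[R]_p)
  (t : nat) : 'M[R]_(p, r) :=
  \sum_(i < t) ((d i - s i) *m (x i)^T).

Definition surrogate (G : {set {set 'I_p}}) (lam1 lam2 : R)
  (d : nat -> 'cV[R]_p) (x : nat -> 'cV[R]_r) (s : nat -> 'cV[R]_p)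
  (t : nat) (L : 'M[R]_(p, r)) : R :=
  t%:R^-1 * (\sum_(i < t) lhat G lam1 lam2 (d i) L (x i) (s i))
  + lam1 / (2 * t%:R) * frob2 L.

Definition empcost (G : {set {set 'I_p}}) (lam1 lam2 : R)
  (d : nat -> 'cV[R]_p) (t : nat) (L : 'M[R]_(p, r)) : R :=
  t%:R^-1 * (\sum_(i < t) ell G lam1 lam2 (d i) L)
  + lam1 / (2 * t%:R) * frob2 L.

Definition olsd (G : {set {set 'I_p}}) (lam1 lam2 : R) (L0 : 'M[R]_(p, r))
  (d : nat -> 'cV[R]_p) (L : nat -> 'M[R]_(p, r))
  (x : nat -> 'cV[R]_r) (s : nat -> 'cV[R]_p) : Prop :=
  [/\ L 0%N = L0,
      forall t, is_minimizer G lam1 lam2 (d t) (L t) (x t) (s t) &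
      forall t, L t.+1 = Bmat d x s t.+1 *m invmx (Amat x t.+1 + lam1%:M)].
End OLSD.

Section IID.
Local Open Scope ereal_scope.
Variables (R : realType) (p : nat) (dsp : measure_display) (T : measurableType dsp).

Definition box_event (d : nat -> T -> 'cV[R]_p) (t : nat) (B : 'I_p -> set R) : set T :=
  [set w | forall i : 'I_p, B i (d t w i ord0)].

(* d_0, d_1, ... are independent, identically distributed random vectors of R^p.
   R^p carries the product (= Borel) sigma-algebra, generated by the pi-system
   of measurable boxes; independence and equality of distributions are
   expressed on that generating pi-system. *)
Definition iid_vectors (P : probability T R) (d : nat -> T -> 'cV[R]_p) : Prop :=
  [/\ (forall t (i : 'I_p), measurable_fun setT (fun w => d t w i ord0)),
      (forall (F : seq nat) (B : nat -> 'I_p -> set R),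
         uniq F -> (forall t i, measurable (B t i)) ->
         P (\big[setI/setT]_(t <- F) box_event d t (B t))
         = (\prod_(t <- F) fine (P (box_event d t (B t))))%R%:E) &
      (forall t (B : 'I_p -> set R), (forall i, measurable (B i)) ->
         P (box_event d t B) = P (box_event d 0%N B))].
End IID.

(* Main.v *)
Require Import Defs.
From HB Require Import structures.
From mathcomp Require Import all_boot all_order all_algebra.
From mathcomp Require Import all_classical all_reals all_analysis.
From mathcomp Require Import measurable_realfun ring lra.
Set Implicit Arguments. Unset Strict Implicit. Unset Printing Implicit Defensive.
Import Order.TTheory GRing.Theory Num.Theory.
Import numFieldNormedType.Exports.
Local Open Scope classical_set_scope.
Local Open Scope ring_scope.

(** The iterates [L_t] need not be bounded and [A_t / t] need not stay away
    from singular matrices, so no compactness of the iterates is used.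

    Write [f L] for the expected loss and [e] for the residual [d - L x - s] of
    a minimizer.  Since [L_t] minimizes [g_t], the online-regret estimate
    [t g_t(L_t) <= C + sum_(i < t) ell(d_i, L_i)] holds, hence [0 <= g_t(L_t) -
    f_t(L_t)] is at most the sum of [C / t], of the mean of the martingale
    differences [ell(d_i, L_i) - f(L_i)], of the Cesaro defect
    [mean_i f(L_i) - f(L_t)], and of [f(L_t) - mean_i ell(d_i, L_t)].  The last
    term vanishes because [ell] is Lipschitz in [d] uniformly in [L], which
    reduces a law of large numbers uniform over all [L] to finitely many boxes.
    So it suffices that [f(L_t)] converges almost surely.

    With [H_t = A_t + lam1 I] and [v = H_t^-1 x] the step is
    [L_(t+1) - L_t = e v^T / (1 + x^T v)], while [ell(d, .)] is bounded above by
    a quadratic touching it at [L_t].  Hence [f(L_(t+1))] is at most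
    [f(L_t) - D H_t^-1 . D + (martingale difference) + K |v|^2], where
    [D = E (e x^T)], and Sherman-Morrison telescopes the errors:
    [sum |v|^2 <= (1 + X / lam1) tr (H_0^-1)] when [|x|^2 <= X].  The martingale
    part has summable variance, so [f(L_t)] converges. *)


(** * Minimizers of the loss *)

(** The fluctuations are martingale differences only if the iterates are adapted, yet the run is an
    arbitrary pathwise choice of minimizers. The loss is strongly convex in [x] and the residual,
    which makes these two unique and continuous in datum and basis; measurability follows by
    induction. No conditional expectation is formed: a compensator freezes the past and integrates
    over a fresh sample, and the martingale property becomes orthogonality to every bounded function
    of the past. As independence is given on boxes only, functions of the data are first quantized
    on a grid, where they are finite sums over box indicators.

    The term with [D] arises because [e x^T] is minus the gradient of the loss at the current basis:
    a step [e v^T] lowers the expected loss to first order by the inner product of [D] and [e v^T],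
    whose mean is nonnegative. The factor [1 / (1 + x^T v)] depends on the current datum and would
    spoil this mean; it differs from 1 by at most [x^T v], so removing it costs only a term of order
    [|v|^2]. *)

Lemma cvg_sum_fin (R : realType) (U I : Type) (F : set_system U) {FF : Filter F}
    (s : seq I) (f : I -> U -> R) (a : I -> R) :
  (forall i, f i u @[u --> F] --> a i) ->
  \sum_(i <- s) f i u @[u --> F] --> \sum_(i <- s) a i.
Proof.
move=> h; elim: s => [|i s IH].
  by under eq_cvg do rewrite big_nil; rewrite big_nil; exact: cvg_cst.
by under eq_cvg do rewrite big_cons; rewrite big_cons; exact: cvgD.
Qed.

Lemma cvg_bigmax_fin (R : realType) (U : topologicalType) (I : Type) (u : U)
    (s : seq I) (Q : pred I) (f : I -> U -> R) :
  (forall i, f i v @[v --> u] --> f i u) ->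
  \big[Num.max/0]_(i <- s | Q i) f i v @[v --> u] -->
  \big[Num.max/0]_(i <- s | Q i) f i u.
Proof.
move=> h; elim: s => [|i s IH].
  by under eq_cvg do rewrite big_nil; rewrite big_nil; exact: cvg_cst.
under eq_cvg do rewrite big_cons; rewrite big_cons; case: (Q i) => //.
exact: (@continuous_max R U (f i) (fun v => \big[Num.max/0]_(i <- s | Q i) f i v) u (h i) IH).
Qed.

Section VectorNorms.
Variable R : realType.

Definition dot n (u v : 'cV[R]_n) : R := \sum_i u i 0 * v i 0.

Lemma l2sq_ge0 n (u : 'cV[R]_n) : 0 <= l2sq u.
Proof. by apply: sumr_ge0 => i _; exact: sqr_ge0. Qed.

Lemma dotxx n (u : 'cV[R]_n) : dot u u = l2sq u.
Proof. by apply: eq_bigr => i _; rewrite expr2. Qed.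

Lemma dotC n (u v : 'cV[R]_n) : dot u v = dot v u.
Proof. by apply: eq_bigr => i _; rewrite mulrC. Qed.

Lemma dotDl n (u v w : 'cV[R]_n) : dot (u + v) w = dot u w + dot v w.
Proof. by rewrite -big_split; apply: eq_bigr => i _; rewrite mxE mulrDl. Qed.

Lemma dotNl n (u w : 'cV[R]_n) : dot (- u) w = - dot u w.
Proof. by rewrite -sumrN; apply: eq_bigr => i _; rewrite mxE mulNr. Qed.

Lemma dotZl n a (u w : 'cV[R]_n) : dot (a *: u) w = a * dot u w.
Proof. by rewrite mulr_sumr; apply: eq_bigr => i _; rewrite mxE mulrA. Qed.

Lemma l2sqD n (u v : 'cV[R]_n) : l2sq (u + v) = l2sq u + 2 * dot u v + l2sq v.
Proof.
rewrite -!dotxx dotDl dotC dotDl [dot v (u + v)]dotC dotDl (dotC v u); ring.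
Qed.

Lemma l2sqZ n a (u : 'cV[R]_n) : l2sq (a *: u) = a ^+ 2 * l2sq u.
Proof. by rewrite -!dotxx dotZl dotC dotZl mulrA. Qed.

Lemma l2sqN n (u : 'cV[R]_n) : l2sq (- u) = l2sq u.
Proof. by rewrite -scaleN1r l2sqZ sqrrN expr1n mul1r. Qed.

Lemma l2sq0 n : l2sq (0 : 'cV[R]_n) = 0.
Proof. by rewrite -(scale0r 0) l2sqZ expr0n mul0r. Qed.

Lemma coord_le_l2sq n (u : 'cV[R]_n) i : u i 0 ^+ 2 <= l2sq u.
Proof. by rewrite /l2sq (bigD1 i)//= lerDl sumr_ge0// => j _; exact: sqr_ge0. Qed.

Lemma dot_sqr_le n (u v : 'cV[R]_n) : dot u v ^+ 2 <= l2sq u * l2sq v.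
Proof.
have [v0|v0] := eqVneq (l2sq v) 0.
  have vi i : v i 0 = 0.
    by apply/eqP; rewrite -sqrf_eq0 eq_le sqr_ge0 -{1}v0 coord_le_l2sq.
  by rewrite v0 mulr0 /dot big1 ?expr0n// => i _; rewrite vi mulr0.
have vp : 0 < l2sq v by rewrite lt_def v0 l2sq_ge0.
have := l2sq_ge0 (l2sq v *: u - dot u v *: v).
rewrite l2sqD l2sqN !l2sqZ dotZl dotC dotNl dotZl (dotC v u).
rewrite (_ : _ + _ + _ = l2sq v * (l2sq u * l2sq v - dot u v ^+ 2)); last by ring.
by rewrite pmulr_rge0// subr_ge0.
Qed.

(** [1 + a] dominates the root of [a]; this crude form turns quadratic bounds into coordinatewise
    ones. *)
Lemma norm_le_of_sqr (y a : R) : y ^+ 2 <= a -> `|y| <= 1 + a.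
Proof.
move=> ya; have a0 : 0 <= a := le_trans (sqr_ge0 y) ya.
rewrite -(@ler_pXn2r _ 2)// ?nnegrE ?addr_ge0// real_normK ?num_real//.
by apply: le_trans ya _; rewrite sqrrD; nra.
Qed.

End VectorNorms.

Section Loss.
Variables (R : realType) (p r : nat) (G : {set {set 'I_p}}) (lam1 lam2 : R).
Hypotheses (lam1_gt0 : 0 < lam1) (lam2_gt0 : 0 < lam2).
Implicit Types (d s : 'cV[R]_p) (L : 'M[R]_(p, r)) (x : 'cV[R]_r).

Local Notation lhat := (lhat G lam1 lam2).
Local Notation ell := (ell G lam1 lam2).
Local Notation is_minimizer := (is_minimizer G lam1 lam2).

(** The penalty on [s] is merely convex, but the loss is strongly convex in the pair of [x] and the
    residual; minimizers are compared through this pair. *)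
Definition residual d L x s : 'cV[R]_p := d - L *m x - s.

Lemma residualE d L x s i :
  residual d L x s i 0 = d i 0 - (\sum_j L i j * x j 0) - s i 0.
Proof. by rewrite !mxE. Qed.

Lemma linf_restr_ge0 s (g : {set 'I_p}) : 0 <= linf_restr s g.
Proof. by apply: (big_ind (fun y => 0 <= y)) => // a b a0 b0; rewrite le_max a0. Qed.

Lemma grpnorm_ge0 s : 0 <= grpnorm G s.
Proof. by apply: sumr_ge0 => g _; exact: linf_restr_ge0. Qed.

Lemma coord_le_linf s (g : {set 'I_p}) i : i \in g -> `|s i 0| <= linf_restr s g.
Proof. by move=> ig; rewrite /linf_restr; apply: (le_bigmax_cond _ (fun i => `|s i 0|)). Qed.

Lemma linf_le s (g : {set 'I_p}) a : 0 <= a -> (forall i, i \in g -> `|s i 0| <= a) ->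
  linf_restr s g <= a.
Proof. by move=> a0 h; apply: bigmax_le. Qed.

Lemma grpnorm_mid s s' :
  grpnorm G (2^-1 *: (s + s')) <= 2^-1 * (grpnorm G s + grpnorm G s').
Proof.
rewrite /grpnorm -big_split mulr_sumr; apply: ler_sum => g _ /=.
apply: linf_le => [|i ig].
  by rewrite mulr_ge0 ?invr_ge0// addr_ge0// linf_restr_ge0.
rewrite !mxE normrM ger0_norm ?invr_ge0// ler_pM2l ?invr_gt0//.
by rewrite (le_trans (ler_normD _ _))// lerD// coord_le_linf.
Qed.

Lemma lhat_ge0 d L x s : 0 <= lhat d L x s.
Proof.
by rewrite /lhat !addr_ge0// ?mulr_ge0 ?l2sq_ge0 ?grpnorm_ge0 ?divr_ge0 ?ltW ?invr_gt0.
Qed.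

Lemma grpnorm0 : grpnorm G (0 : 'cV[R]_p) = 0.
Proof.
apply/eqP; rewrite eq_le grpnorm_ge0 andbT sumr_le0// => g _.
by apply: linf_le => // i _; rewrite mxE normr0.
Qed.

Lemma lhat00 d L : lhat d L 0 0 = 2^-1 * l2sq d.
Proof. by rewrite /lhat mulmx0 !subr0 l2sq0 grpnorm0 !mulr0 !addr0. Qed.

Lemma lhatE d L x s :
  lhat d L x s = 2^-1 * l2sq (residual d L x s) + lam1 / 2 * l2sq x + lam2 * grpnorm G s.
Proof. by []. Qed.

(** At fixed [(x, s)] the loss is quadratic in the residual, and [del] is the drop of the residual,
    so the expansion is exact. Stability, the quadratic majorant of [ell] and the optimality of the
    ridge solution all start from it. *)
Lemma lhat_change d d' L L' x s (del := (d - d') - (L - L') *m x) :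
  lhat d' L' x s = lhat d L x s - dot (residual d L x s) del + 2^-1 * l2sq del.
Proof.
rewrite !lhatE; have -> : residual d' L' x s = residual d L x s + - del.
  rewrite /del /residual mulmxBl; apply/matrixP => i j; rewrite !mxE; ring.
by rewrite l2sqD l2sqN [dot _ (- _)]dotC dotNl [dot del _]dotC; lra.
Qed.

(** Optimality is tested at the midpoint only. By the parallelogram law the squared terms lie there
    below the average of the endpoints by [1/8] and [lam1 / 8] of the squared distances; doubling
    gives the constants. *)
Lemma minimizer_growth d L x s x' s' : is_minimizer d L x s ->
  lhat d L x s + 4^-1 * l2sq (residual d L x s - residual d L x' s')
    + lam1 / 4 * l2sq (x - x') <= lhat d L x' s'.
Proof.
move=> /(_ (2^-1 *: (x + x')) (2^-1 *: (s + s'))).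
have := grpnorm_mid s s'; rewrite !lhatE.
have -> : residual d L (2^-1 *: (x + x')) (2^-1 *: (s + s')) =
    2^-1 *: (residual d L x s + residual d L x' s').
  rewrite /residual -scalemxAr mulmxDr; by apply/matrixP => i j; rewrite !mxE; lra.
move: (residual d L x s) (residual d L x' s') => e e'.
rewrite !l2sqZ !l2sqD !l2sqN ![dot _ (- _)]dotC !dotNl (dotC e' e) (dotC x' x).
set gm := grpnorm G (_ *: _) => hg h.
have hg' := ler_wpM2l (ltW lam2_gt0) hg.
by lra.
Qed.

(** The competitor [(0, 0)] costs half of [l2sq d] whatever the basis. As [L] is absent from the
    bounds, later constants are uniform over unbounded iterates. *)
Lemma minimizer_bounds d L x s : is_minimizer d L x s ->
  l2sq (residual d L x s) <= l2sq d /\ lam1 * l2sq x <= l2sq d.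
Proof.
move=> /(_ 0 0); rewrite lhat00 lhatE.
have h1 := l2sq_ge0 (residual d L x s).
have h2 : 0 <= lam1 * l2sq x by rewrite mulr_ge0 ?l2sq_ge0 ?ltW.
have h3 : 0 <= lam2 * grpnorm G s by rewrite mulr_ge0 ?grpnorm_ge0 ?ltW.
by move=> h; split; lra.
Qed.

Lemma ellE d L x s : is_minimizer d L x s -> ell d L = lhat d L x s.
Proof.
move=> hm; apply/eqP; rewrite eq_le; apply/andP; split.
  apply: ge_inf; last by exists (x, s).
  by exists 0 => _ [z _ <-]; exact: lhat_ge0.
by apply: lb_le_inf; [exists (lhat d L x s), (x, s)|move=> _ [z _ <-]; exact: hm].
Qed.

Lemma ell_le d L x s : ell d L <= lhat d L x s.
Proof.
apply: ge_inf; last by exists (x, s).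
by exists 0 => _ [z _ <-]; exact: lhat_ge0.
Qed.

Lemma minimizer_ex d L : exists z, is_minimizer d L z.1 z.2.
Proof.
(* Coordinate bounds for a competitor no worse than [(0, 0)]: [c0] for the datum and the residual,
   [c1] for [x]. The radius [K] adds the resulting bound on [s = d - residual - L x]. *)
pose c0 := 1 + l2sq d; pose c1 := 1 + l2sq d / lam1.
pose K := c1 + (2 * c0 + \sum_i \sum_j `|L i j| * c1).
have c0_ge0 : 0 <= c0 by rewrite addr_ge0// l2sq_ge0.
have c1_ge0 : 0 <= c1 by rewrite addr_ge0// divr_ge0 ?l2sq_ge0// ltW.
have LK i : 0 <= \sum_j `|L i j| * c1 by apply: sumr_ge0 => j _; exact: mulr_ge0.
have LLK : 0 <= \sum_i \sum_j `|L i j| * c1 by exact: sumr_ge0.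
have K0 : 0 <= K by rewrite /K addr_ge0// addr_ge0// mulr_ge0.
pose xz (z : 'rV[R]_(r + p)) := (lsubmx z)^T; pose sz (z : 'rV[R]_(r + p)) := (rsubmx z)^T.
pose f z := lhat d L (xz z) (sz z).
pose A := [set z : 'rV[R]_(r + p) | forall i, `[- K, K]%classic (z ord0 i)].
have A0 : A 0 by move=> i; rewrite mxE /= in_itv /= oppr_le0 K0.
have cA : compact A.
  by apply: (@rV_compact _ _ (fun=> `[- K, K]%classic)) => i; exact: segment_compact.
have cf : continuous f.
  move=> z; have cz i : (fun z : 'rV[R]_(r + p) => z ord0 i) y @[y --> z] --> z ord0 i.
    exact: coord_continuous.
  have cx j : xz y j 0 @[y --> z] --> xz z j 0.
    by under eq_cvg do rewrite !mxE; rewrite !mxE; exact: cz.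
  have cs j : sz y j 0 @[y --> z] --> sz z j 0.
    by under eq_cvg do rewrite !mxE; rewrite !mxE; exact: cz.
  have ce i : residual d L (xz y) (sz y) i 0 @[y --> z] --> residual d L (xz z) (sz z) i 0.
    under eq_cvg do rewrite residualE; rewrite residualE; apply: cvgB (cs i).
    apply: cvgB; first exact: cvg_cst.
    by apply: cvg_sum_fin => j; apply: cvgMl_tmp; exact: cx.
  have cq n (h : 'rV[R]_(r + p) -> 'cV[R]_n) :
      (forall i, h y i 0 @[y --> z] --> h z i 0) -> l2sq (h y) @[y --> z] --> l2sq (h z).
    move=> ch; apply: (@cvg_sum_fin R _ _ (nbhs z) _ _ (fun i y => h y i 0 ^+ 2)
      (fun i => h z i 0 ^+ 2)) => i.
    exact: (cvgM (ch i) (ch i)).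
  have cg : grpnorm G (sz y) @[y --> z] --> grpnorm G (sz z).
    rewrite /grpnorm big_mkcond; under eq_cvg do rewrite big_mkcond.
    apply: (@cvg_sum_fin R _ _ (nbhs z) _ _
      (fun g y => if g \in G then linf_restr (sz y) g else 0)
      (fun g => if g \in G then linf_restr (sz z) g else 0)) => g.
    case: (g \in G); last exact: cvg_cst.
    by apply: (@cvg_bigmax_fin R _ _ z _ _ (fun i y => `|sz y i 0|)) => i;
      exact: cvg_norm (cs i).
  exact: (cvgD (cvgD (cvgMl_tmp (cq _ _ ce)) (cvgMl_tmp (cq _ _ cx))) (cvgMl_tmp cg)).
have [z zA zmin] := compact_EVT_min (ex_intro _ _ A0) cA (continuous_subspaceT cf).
exists (xz z, sz z) => x' s' /=.
(* A competitor worse than [(0, 0)] needs no bound, since the box contains 0. *)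
have [h|/ltW h] := leP (lhat d L x' s') (2^-1 * l2sq d); last first.
  apply: le_trans h; have /= := zmin 0 (mem_set A0).
  have x0 : xz 0 = 0 by apply/matrixP => i j; rewrite !mxE.
  have s0 : sz 0 = 0 by apply/matrixP => i j; rewrite !mxE.
  by rewrite /f x0 s0 lhat00.
have h1 : 0 <= lam1 * l2sq x' by rewrite mulr_ge0 ?l2sq_ge0 ?ltW.
have h2 : 0 <= lam2 * grpnorm G s' by rewrite mulr_ge0 ?grpnorm_ge0 ?ltW.
have h3 := l2sq_ge0 (residual d L x' s').
move: h; rewrite lhatE => h.
have e_le i : `|residual d L x' s' i 0| <= c0.
  by apply: norm_le_of_sqr; rewrite (le_trans (coord_le_l2sq _ i))//; lra.
have d_le i : `|d i 0| <= c0 by apply: norm_le_of_sqr; exact: coord_le_l2sq.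
have x_le j : `|x' j 0| <= c1.
  apply: norm_le_of_sqr; rewrite (le_trans (coord_le_l2sq _ j))//.
  by rewrite ler_pdivlMr// mulrC; lra.
(* The penalty ignores coordinates outside every group, so [s'] is bounded through the residual. *)
have s_le i : `|s' i 0| <= 2 * c0 + \sum_i \sum_j `|L i j| * c1.
  have -> : s' i 0 = d i 0 - residual d L x' s' i 0 - (L *m x') i 0.
    by rewrite !mxE; ring.
  rewrite (le_trans (ler_normB _ _))//; apply: lerD.
    by rewrite (le_trans (ler_normB _ _))// mulr2n mulrDl mul1r lerD.
  rewrite (bigD1 i)//= ler_wpDr ?sumr_ge0// mxE (le_trans (ler_norm_sum _ _ _))//.
  by apply: ler_sum => j _; rewrite normrM ler_pM.
pose z' : 'rV[R]_(r + p) := row_mx x'^T s'^T.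
have z'A : A z'.
  move=> i; rewrite /= in_itv /= -ler_norml /z' mxE.
  case: (fintype.split i) => j; rewrite mxE.
    by rewrite (le_trans (x_le j))// lerDl addr_ge0// mulr_ge0.
  by rewrite (le_trans (s_le j))// lerDr.
have := zmin z' (mem_set z'A); rewrite /f /xz /sz /z' row_mxKl row_mxKr !trmxK.
by [].
Qed.

Definition argmin d L : 'cV[R]_r * 'cV[R]_p :=
  xget (0, 0) [set z | is_minimizer d L z.1 z.2].
Definition xmin d L : 'cV[R]_r := (argmin d L).1.
Definition rmin d L : 'cV[R]_p := residual d L (argmin d L).1 (argmin d L).2.

Lemma argminP d L : is_minimizer d L (argmin d L).1 (argmin d L).2.
Proof.
exact: (@xgetPex _ (0, 0) [set z | is_minimizer d L z.1 z.2] (minimizer_ex d L)).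
Qed.

(* Adds the optimality of [(x, s)] with its quadratic growth to the plain
   optimality of [(x', s')]. *)
Lemma minimizer_stability d L x s d' L' x' s'
    (del := (d - d') - (L - L') *m x) (del' := (d - d') - (L - L') *m x') :
  is_minimizer d L x s -> is_minimizer d' L' x' s' ->
  4^-1 * l2sq (residual d L x s - residual d' L' x' s' - del')
    + lam1 / 4 * l2sq (x - x') <=
  dot (residual d' L' x' s') del' + 2^-1 * l2sq del'
    - dot (residual d L x s) del + 2^-1 * l2sq del.
Proof.
move=> hm hm'; have := minimizer_growth x' s' hm; have := hm' x s.
rewrite (lhat_change d d' L L' x s) -/del.
have E : residual d L x' s' = residual d' L' x' s' + del'.
  by rewrite /del' /residual mulmxBl; apply/matrixP => i j; rewrite !mxE; ring.
have -> : residual d L x s - residual d L x' s' =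
    residual d L x s - residual d' L' x' s' - del' by rewrite E opprD addrA.
rewrite (lhat_change d d' L L' x' s') -/del' E dotDl dotxx.
by move=> h1 h2; lra.
Qed.

Lemma minimizer_unique d L x s x' s' :
  is_minimizer d L x s -> is_minimizer d L x' s' ->
  x = x' /\ residual d L x s = residual d L x' s'.
Proof.
move=> hm hm'; have := minimizer_stability hm hm'.
rewrite !subrr !mul0mx !subr0 l2sq0 mulr0 !addr0.
have z0 n (u : 'cV[R]_n) : dot u 0 = 0.
  by rewrite /dot big1// => i _; rewrite mxE mulr0.
rewrite !z0 subr0 => h.
have h1 := l2sq_ge0 (residual d L x s - residual d L x' s').
have h2 : 0 <= lam1 * l2sq (x - x') by rewrite mulr_ge0 ?l2sq_ge0 ?ltW.
have e1 : l2sq (residual d L x s - residual d L x' s') = 0 by lra.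
have e2 : l2sq (x - x') = 0.
  apply/eqP; have /eqP : lam1 * l2sq (x - x') = 0 by lra.
  by rewrite mulf_eq0 gt_eqF.
have zero n (u : 'cV[R]_n) : l2sq u = 0 -> u = 0.
  move=> u0; apply/matrixP => i j; rewrite (ord1 j) mxE.
  by apply/eqP; rewrite -sqrf_eq0 eq_le sqr_ge0 -{1}u0 coord_le_l2sq.
by split; apply/eqP; rewrite -subr_eq0; apply/eqP; exact: zero.
Qed.

(** Links the minimizers of an arbitrary run, which carry no measurability, to functions of [(d, L)]
    that turn out to be continuous. *)
Lemma minimizer_xmin d L x s : is_minimizer d L x s ->
  x = xmin d L /\ residual d L x s = rmin d L.
Proof. by move=> hm; exact: minimizer_unique hm (argminP d L). Qed.

Lemma rmin_le d L : l2sq (rmin d L) <= l2sq d.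
Proof. exact: (minimizer_bounds (argminP d L)).1. Qed.

Lemma xmin_le d L : l2sq (xmin d L) <= l2sq d / lam1.
Proof.
by rewrite ler_pdivlMr// mulrC; exact: (minimizer_bounds (argminP d L)).2.
Qed.

Lemma ell_argmin d L : ell d L = lhat d L (argmin d L).1 (argmin d L).2.
Proof. by apply: ellE; exact: argminP. Qed.

Lemma ell_ge0 d L : 0 <= ell d L.
Proof. by rewrite ell_argmin lhat_ge0. Qed.

Lemma ell_le_l2sq d L : ell d L <= 2^-1 * l2sq d.
Proof. by rewrite -(lhat00 d L); exact: ell_le. Qed.

(** The minimizer at [(d, L)] serves as competitor at [(d', L')]; exchanging the two points gives a
    lower bound as well. *)
Lemma ell_change d d' L L' :
  ell d' L' <= ell d L - dot (rmin d L) ((d - d') - (L - L') *m xmin d L)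
    + 2^-1 * l2sq ((d - d') - (L - L') *m xmin d L).
Proof.
rewrite (ell_argmin d L) /xmin /rmin.
by have <- := lhat_change d d' L L' (argmin d L).1 (argmin d L).2; exact: ell_le.
Qed.

(** * Continuity of the minimizer and of the loss *)

Section Continuity.
Variables (d_ : nat -> 'cV[R]_p) (L_ : nat -> 'M[R]_(p, r)).
Variables (d : 'cV[R]_p) (L : 'M[R]_(p, r)).
Hypothesis cd : forall i, d_ n i 0 @[n --> \oo] --> d i 0.
Hypothesis cL : forall i j, L_ n i j @[n --> \oo] --> L i j.

Lemma cvg0_mul_bounded (u v : nat -> R) (C : R) :
  u n @[n --> \oo] --> (0 : R) -> (forall n, `|v n| <= C) ->
  v n * u n @[n --> \oo] --> (0 : R).
Proof.
move=> cu vC; apply: norm_cvg0.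
have cC : C * `|u n| @[n --> \oo] --> (0 : R).
  by rewrite -[X in _ --> X](mulr0 C); apply: cvgMl_tmp; rewrite -[X in _ --> X](normr0 R); exact: cvg_norm cu.
apply: (squeeze_cvgr _ (cvg_cst (0 : R)) cC).
by apply: nearW => n; rewrite normr_ge0 normrM ler_wpM2r.
Qed.

Let cd0 i : (d i 0 - d_ n i 0) @[n --> \oo] --> (0 : R).
Proof. by rewrite -[X in _ --> X](subrr (d i 0)); exact: (cvgB (cvg_cst _) (@cd i)). Qed.

Let cL0 i j : (L i j - L_ n i j) @[n --> \oo] --> (0 : R).
Proof. by rewrite -[X in _ --> X](subrr (L i j)); exact: (cvgB (cvg_cst _) (@cL i j)). Qed.

Let cl2sq : l2sq (d_ n) @[n --> \oo] --> l2sq d.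
Proof. by apply: cvg_sum_fin => i; exact: cvgM. Qed.

Let dbound : exists C : R, forall n, l2sq (d_ n) <= C.
Proof.
have /cvg_seq_bounded [C [_ hC]] : cvgn (fun n => l2sq (d_ n)).
  by apply/cvg_ex; exists (l2sq d); exact: cl2sq.
exists (C + 1) => n; apply: le_trans (ler_norm _) _.
by apply: (hC (C + 1)) => //; rewrite ltrDl.
Qed.

Let dl n (x : 'cV[R]_r) : 'cV[R]_p := (d - d_ n) - (L - L_ n) *m x.

Let cdl (x_ : nat -> 'cV[R]_r) (C : R) i : (forall n j, `|x_ n j 0| <= C) ->
  dl n (x_ n) i 0 @[n --> \oo] --> (0 : R).
Proof.
move=> xC.
have h : ((d i 0 - d_ n i 0) - \sum_j x_ n j 0 * (L i j - L_ n i j))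
    @[n --> \oo] --> (0 - \sum_(j < r) 0 : R).
  apply: (cvgB (@cd0 i)); apply: cvg_sum_fin => j.
  exact: (@cvg0_mul_bounded (fun n => L i j - L_ n i j) (fun n => x_ n j 0) C).
rewrite big1_eq subr0 in h; apply: cvg_trans h; apply: near_eq_cvg; apply: nearW => n.
by rewrite !mxE; congr (_ - _); apply: eq_bigr => j _; rewrite !mxE mulrC.
Qed.

Let cdot (u_ v_ : nat -> 'cV[R]_p) (C : R) : (forall n i, `|u_ n i 0| <= C) ->
  (forall i, v_ n i 0 @[n --> \oo] --> (0 : R)) ->
  dot (u_ n) (v_ n) @[n --> \oo] --> (0 : R).
Proof.
move=> uC cv.
suff : dot (u_ n) (v_ n) @[n --> \oo] --> (\sum_(i < p) 0 : R) by rewrite big1_eq.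
apply: cvg_sum_fin => i.
exact: (@cvg0_mul_bounded (fun n => v_ n i 0) (fun n => u_ n i 0) C).
Qed.

Let cl2 (v_ : nat -> 'cV[R]_p) : (forall i, v_ n i 0 @[n --> \oo] --> (0 : R)) ->
  l2sq (v_ n) @[n --> \oo] --> (0 : R).
Proof.
move=> cv.
suff : l2sq (v_ n) @[n --> \oo] --> (\sum_(i < p) 0 * 0 : R) by rewrite mul0r big1_eq.
by apply: cvg_sum_fin => i; exact: cvgM.
Qed.

Let del n := dl n (xmin d L).
Let del' n := dl n (xmin (d_ n) (L_ n)).

Let xbound : exists C : R, forall n j, `|xmin (d_ n) (L_ n) j 0| <= C.
Proof.
have [C hC] := dbound; exists (1 + C / lam1) => n j; apply: norm_le_of_sqr.
rewrite (le_trans (coord_le_l2sq _ j))// (le_trans (xmin_le _ _))//.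
by rewrite ler_pM2r ?invr_gt0.
Qed.

Let rbound : exists C : R, forall n i, `|rmin (d_ n) (L_ n) i 0| <= C.
Proof.
have [C hC] := dbound; exists (1 + C) => n i; apply: norm_le_of_sqr.
by rewrite (le_trans (coord_le_l2sq _ i))// (le_trans (rmin_le _ _)).
Qed.

Let cdel i : del n i 0 @[n --> \oo] --> (0 : R).
Proof.
apply: (@cdl (fun=> xmin d L) (\sum_j `|xmin d L j 0|)) => _ j.
by rewrite (bigD1 j)//= lerDl sumr_ge0.
Qed.

Let cdel' i : del' n i 0 @[n --> \oo] --> (0 : R).
Proof. by have [C hC] := xbound; exact: (@cdl (fun n => xmin (d_ n) (L_ n)) C). Qed.

Let cdot_del : dot (rmin d L) (del n) @[n --> \oo] --> (0 : R).
Proof.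
apply: (@cdot (fun=> rmin d L) del (\sum_j `|rmin d L j 0|)) => [_ j|i]; last exact: cdel.
by rewrite (bigD1 j)//= lerDl sumr_ge0.
Qed.

Let cdot_del' : dot (rmin (d_ n) (L_ n)) (del' n) @[n --> \oo] --> (0 : R).
Proof.
have [C hC] := rbound.
by apply: (@cdot (fun n => rmin (d_ n) (L_ n)) del' C) => // i; exact: cdel'.
Qed.

(** The right-hand side of [minimizer_stability]. It tends to 0 because the increments do while the
    minimizers along the sequence stay bounded; that limit in turn forces the minimizers to
    converge. *)
Let gap n := dot (rmin (d_ n) (L_ n)) (del' n) + 2^-1 * l2sq (del' n)
    - dot (rmin d L) (del n) + 2^-1 * l2sq (del n).

Let cgap : gap n @[n --> \oo] --> (0 : R).
Proof.
have -> : (0 : R) = 0 + 2^-1 * 0 - 0 + 2^-1 * 0 by rewrite mulr0 !addr0 subr0.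
apply: cvgD; last by apply: cvgMl_tmp; apply: cl2 => i; exact: cdel.
apply: cvgB cdot_del; apply: cvgD cdot_del' _.
by apply: cvgMl_tmp; apply: cl2 => i; exact: cdel'.
Qed.

Let le_gap n : 4^-1 * l2sq (rmin d L - rmin (d_ n) (L_ n) - del' n)
    + lam1 / 4 * l2sq (xmin d L - xmin (d_ n) (L_ n)) <= gap n.
Proof. exact: minimizer_stability (argminP _ _) (argminP _ _). Qed.

Let cvg0_of_sqr (u : nat -> R) (C : R) : (forall n, u n ^+ 2 <= C * gap n) ->
  u n @[n --> \oo] --> (0 : R).
Proof.
move=> h; apply: norm_cvg0; apply/cvgrPdist_le => e e0.
have c : C * gap n @[n --> \oo] --> (0 : R).
  by rewrite -[X in _ --> X](mulr0 C); exact: cvgMl_tmp cgap.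
have e20 : 0 < e ^+ 2 by rewrite exprn_gt0.
move/cvgrPdist_le/(_ _ e20): c; apply: filterS => n.
rewrite !sub0r !normrN normr_id => hn.
rewrite -(@ler_pXn2r _ 2)// ?nnegrE ?(ltW e0)// real_normK ?num_real//.
by apply: le_trans (h n) _; apply: le_trans (ler_norm _) hn.
Qed.

Lemma xmin_cvg j : xmin (d_ n) (L_ n) j 0 @[n --> \oo] --> xmin d L j 0.
Proof.
have c : (xmin d L j 0 - xmin (d_ n) (L_ n) j 0) @[n --> \oo] --> (0 : R).
  apply: (@cvg0_of_sqr _ (4 / lam1)) => n.
  have h := coord_le_l2sq (xmin d L - xmin (d_ n) (L_ n)) j; rewrite !mxE in h.
  apply: le_trans h _; rewrite mulrAC ler_pdivlMr// mulrC.
  have := le_gap n; have := l2sq_ge0 (rmin d L - rmin (d_ n) (L_ n) - del' n).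
  by move=> h1 h2; lra.
have h : (xmin d L j 0 - (xmin d L j 0 - xmin (d_ n) (L_ n) j 0))
    @[n --> \oo] --> (xmin d L j 0 - 0 : R) by apply: cvgB => //; exact: cvg_cst.
rewrite subr0 in h; apply: cvg_trans h; apply: near_eq_cvg; apply: nearW => n.
by rewrite subKr.
Qed.

Lemma rmin_cvg i : rmin (d_ n) (L_ n) i 0 @[n --> \oo] --> rmin d L i 0.
Proof.
have c : (rmin d L i 0 - rmin (d_ n) (L_ n) i 0 - del' n i 0) @[n --> \oo] --> (0 : R).
  apply: (@cvg0_of_sqr _ 4) => n.
  have h := coord_le_l2sq (rmin d L - rmin (d_ n) (L_ n) - del' n) i.
  have sub2E (a b c : 'cV[R]_p) : (a - b - c) i 0 = a i 0 - b i 0 - c i 0 by rewrite !mxE.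
  rewrite sub2E in h.
  apply: le_trans h _.
  have := le_gap n.
  have : 0 <= lam1 * l2sq (xmin d L - xmin (d_ n) (L_ n)).
    by rewrite mulr_ge0 ?l2sq_ge0 ?ltW.
  by move=> h1 h2; lra.
have h : (rmin d L i 0 - (rmin d L i 0 - rmin (d_ n) (L_ n) i 0 - del' n i 0)
    - del' n i 0) @[n --> \oo] --> (rmin d L i 0 - 0 - 0 : R).
  by apply: cvgB; [apply: cvgB => //; exact: cvg_cst|exact: cdel'].
rewrite !subr0 in h; apply: cvg_trans h; apply: near_eq_cvg; apply: nearW => n.
have E (a b f : R) : a - (a - b - f) - f = b by ring.
by rewrite E.
Qed.

Lemma ell_cvg : ell (d_ n) (L_ n) @[n --> \oo] --> ell d L.
Proof.
have c : (ell (d_ n) (L_ n) - ell d L) @[n --> \oo] --> (0 : R).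
  (* The majorant taken at the moving point gives the lower bound, the one taken at the limit gives
     [hi]. *)
  have lo : (- dot (rmin (d_ n) (L_ n)) (del' n) - 2^-1 * l2sq (del' n))
      @[n --> \oo] --> (0 : R).
    have -> : (0 : R) = - 0 - 2^-1 * 0 by rewrite mulr0 subr0 oppr0.
    apply: cvgB; first exact: cvgN cdot_del'.
    by apply: cvgMl_tmp; apply: cl2 => i; exact: cdel'.
  have hi : (- dot (rmin d L) (del n) + 2^-1 * l2sq (del n)) @[n --> \oo] --> (0 : R).
    have -> : (0 : R) = - 0 + 2^-1 * 0 by rewrite mulr0 oppr0 addr0.
    apply: cvgD; first exact: cvgN cdot_del.
    by apply: cvgMl_tmp; apply: cl2 => i; exact: cdel.
  apply: squeeze_cvgr lo hi; apply: nearW => n; apply/andP; split.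
    have := ell_change (d_ n) d (L_ n) L.
    have -> : d_ n - d - (L_ n - L) *m xmin (d_ n) (L_ n) = - del' n.
      by rewrite -(opprB d) -(opprB L) mulNmx -opprD.
    rewrite l2sqN dotC dotNl dotC opprK => h; lra.
  by have := ell_change d (d_ n) L (L_ n); rewrite -/(dl n _) -/(del n) => h; lra.
have h : (ell (d_ n) (L_ n) - ell d L + ell d L) @[n --> \oo] --> (0 + ell d L : R).
  by apply: cvgD => //; exact: cvg_cst.
rewrite add0r in h; apply: cvg_trans h; apply: near_eq_cvg; apply: nearW => n.
by rewrite subrK.
Qed.

End Continuity.

End Loss.

(** * Bounded random variables and martingale differences *)

Section BoundedMeasurable.
Context (R : realType) (dsp : measure_display) (T : measurableType dsp).
Implicit Types f g : T -> R.

(** All integrands that occur are bounded, so this class, closed under sums and products, settles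
    every integrability condition. *)
Definition bmeas f := measurable_fun setT f /\ exists C : R, forall w, `|f w| <= C.

Lemma bmeas_cst (c : R) : bmeas (fun=> c).
Proof. by split; [exact: measurable_cst | exists `|c|]. Qed.

Lemma bmeasD f g : bmeas f -> bmeas g -> bmeas (fun w => f w + g w).
Proof.
move=> [mf [C hC]] [mg [D hD]]; split; first exact: measurable_funD.
by exists (C + D) => w; rewrite (le_trans (ler_normD _ _))// lerD.
Qed.

Lemma bmeasM f g : bmeas f -> bmeas g -> bmeas (fun w => f w * g w).
Proof.
move=> [mf [C hC]] [mg [D hD]]; split; first exact: measurable_funM.
by exists (C * D) => w; rewrite normrM ler_pM.
Qed.

Lemma bmeasZ c f : bmeas f -> bmeas (fun w => c * f w).
Proof. by move=> bf; apply: bmeasM => //; exact: bmeas_cst. Qed.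

Lemma bmeasN f : bmeas f -> bmeas (fun w => - f w).
Proof.
move=> /(bmeasZ (-1)); rewrite (_ : (fun w => - f w) = (fun w => -1 * f w))//.
by apply/funext => w; rewrite mulN1r.
Qed.

Lemma bmeasB f g : bmeas f -> bmeas g -> bmeas (fun w => f w - g w).
Proof. by move=> bf bg; apply: bmeasD => //; exact: bmeasN. Qed.

Lemma bmeas_sqr f : bmeas f -> bmeas (fun w => f w ^+ 2).
Proof. by move=> bf; apply: bmeasM. Qed.

Lemma bmeas_sum (I : Type) (s : seq I) (Q : pred I) (F : I -> T -> R) :
  (forall i, bmeas (F i)) -> bmeas (fun w => \sum_(i <- s | Q i) F i w).
Proof.
move=> bF; elim: s => [|i s IH].
  rewrite (_ : (fun w => _) = fun=> 0); first exact: bmeas_cst.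
  by apply/funext => w; rewrite big_nil.
rewrite (_ : (fun w => _) = fun w => if Q i then
  F i w + \sum_(j <- s | Q j) F j w else \sum_(j <- s | Q j) F j w).
  by case: (Q i) => //; exact: bmeasD.
by apply/funext => w; rewrite big_cons.
Qed.

Lemma bmeas_indic (A : set T) : measurable A -> bmeas (\1_A : T -> R).
Proof.
move=> mA; split; first exact: measurable_indic.
by exists 1 => w; rewrite indicE; case: (_ \in _); rewrite ?normr1 ?normr0.
Qed.

End BoundedMeasurable.

Section Expectation.
Context (R : realType) (dsp : measure_display) (T : measurableType dsp).
Variable P : probability T R.
Implicit Types f g : T -> R.

Lemma bmeas_integrable f : bmeas f -> P.-integrable setT (EFin \o f).
Proof.
move=> [mf [C hC]]; apply: measurable_bounded_integrable => //.
- by apply: le_lt_trans (ltry 1); exact: probability_le1.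
- exists C; split; first by rewrite num_real.
  by move=> x Cx w _; apply: le_trans (hC w) _; exact: ltW.
Qed.

Local Notation E f := (Rintegral P setT f).

Lemma expD f g : bmeas f -> bmeas g -> E (fun w => f w + g w) = E f + E g.
Proof. by move=> bf bg; rewrite RintegralD//; exact: bmeas_integrable. Qed.

Lemma expZ c f : bmeas f -> E (fun w => c * f w) = c * E f.
Proof. by move=> bf; rewrite RintegralZl//; exact: bmeas_integrable. Qed.

Lemma expB f g : bmeas f -> bmeas g -> E (fun w => f w - g w) = E f - E g.
Proof. by move=> bf bg; rewrite RintegralB//; exact: bmeas_integrable. Qed.

Lemma exp_cst c : E (fun=> c) = c.
Proof.
rewrite Rintegral_cst// (_ : fine _ = 1) ?mulr1//.
by rewrite -[RHS]/(fine 1%E); congr fine; exact: probability_setT.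
Qed.

Lemma exp_le f g : bmeas f -> bmeas g -> (forall w, f w <= g w) -> E f <= E g.
Proof.
by move=> bf bg fg; apply: le_Rintegral => //; exact: bmeas_integrable.
Qed.

Lemma exp_ge0 f : (forall w, 0 <= f w) -> 0 <= E f.
Proof. by move=> f0; apply: Rintegral_ge0. Qed.

Lemma exp_sum (I : Type) (s : seq I) (F : I -> T -> R) :
  (forall i, bmeas (F i)) ->
  E (fun w => \sum_(i <- s) F i w) = \sum_(i <- s) E (F i).
Proof.
move=> bF; elim: s => [|i s IH].
  by under eq_Rintegral do rewrite big_nil; rewrite exp_cst big_nil.
under eq_Rintegral do rewrite big_cons.
by rewrite expD ?IH ?big_cons//; exact: bmeas_sum.
Qed.

Lemma exp_indic (A : set T) : measurable A -> E (\1_A : T -> R) = fine (P A).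
Proof. by move=> mA; rewrite /Rintegral integral_indic// setIT. Qed.

Lemma exp_norm_le f c : bmeas f -> (forall w, `|f w| <= c) -> `|E f| <= c.
Proof.
move=> bf fc; rewrite ler_norml -{1}(exp_cst (- c)) -{2}(exp_cst c).
apply/andP; split; apply: exp_le => //; try exact: bmeas_cst.
- by move=> w; have := fc w; rewrite ler_norml => /andP[].
- by move=> w; have := fc w; rewrite ler_norml => /andP[].
Qed.

Lemma chebyshev_sqr f (e : R) : 0 < e -> bmeas f ->
  (P [set w | e < `|f w|]%R <= (E (fun w => f w ^+ 2) / e ^+ 2)%:E)%E.
Proof.
move=> e0 bf.
have mA : measurable [set w | e < `|f w|]%R.
  have mabs : measurable_fun setT (fun w => `|f w|).
    by apply: measurableT_comp => //; case: bf.
  have /(_ measurableT [set true] I) := measurable_fun_ltr (measurable_cst e) mabs.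
  by rewrite setTI.
rewrite -[X in (X <= _)%E]fineK ?fin_num_measure//.
rewrite lee_fin ler_pdivlMr ?exprn_gt0// mulrC -exp_indic//.
rewrite -expZ; [apply: exp_le|exact: bmeas_indic].
- exact/bmeasZ/bmeas_indic.
- exact: bmeas_sqr.
- move=> w; rewrite indicE; case: (boolP (w \in _)) => [|_]; last first.
    by rewrite mulr0 sqr_ge0.
  rewrite inE /= => ew; rewrite mulr1 -[f w ^+ 2]real_normK ?num_real//.
  by rewrite ler_pXn2r// ?nnegrE ?ltW// (lt_trans e0).
Qed.

Lemma bounded_convergence (F : nat -> T -> R) f (C : R) :
  (forall n, measurable_fun setT (F n)) -> (forall n w, `|F n w| <= C) ->
  (forall w, F ^~ w @ \oo --> f w) ->
  bmeas f /\ (E (F n) @[n --> \oo] --> E f).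
Proof.
move=> mF hC cF.
have bF n : bmeas (F n) by split => //; exists C.
have mf : measurable_fun setT f by apply: (measurable_fun_cvg mF) => w _; exact: cF.
have fC w : `|f w| <= C.
  have : (fun n => `|F n w|) @ \oo --> `|f w| by apply: cvg_norm; exact: cF.
  move=> h; rewrite -(cvg_lim _ h)//; apply: limr_le.
    by apply/cvg_ex; eexists; exact: h.
  by apply: nearW => n.
have bf : bmeas f by split => //; exists C.
split => //.
have c1 : {ae P, forall w, setT w -> (F n w)%:E @[n --> \oo] --> (EFin \o f) w}.
  by apply: aeW => w _; apply: cvg_EFin; [exact: nearW|exact: cF].
have c2 : {ae P, forall w n, setT w -> (`|(F n w)%:E| <= C%:E)%E}.
  by apply: aeW => w n _; rewrite lee_fin.
have [_ _] := @dominated_convergence _ T R P setT measurableT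
  (fun n w => (F n w)%:E) (EFin \o f) (fun=> C%:E)
  (fun n => (measurable_EFinP _ _).2 (mF n))
  ((measurable_EFinP _ _).2 mf) c1 (bmeas_integrable (bmeas_cst T C)) c2.
by move=> h; apply: fine_cvg; rewrite fineK// (integrable_fin_num _ (bmeas_integrable bf)).
Qed.

Lemma bounded_convergenceM phi (F : nat -> T -> R) f (C : R) : bmeas phi ->
  (forall n, measurable_fun setT (F n)) -> (forall n w, `|F n w| <= C) ->
  (forall w, F ^~ w @ \oo --> f w) ->
  E (fun w => phi w * F n w) @[n --> \oo] --> E (fun w => phi w * f w).
Proof.
move=> [mphi [D hD]] mF hC cF.
apply: (@bounded_convergence (fun n w => phi w * F n w) _ (D * C) _ _ _).2.
- by move=> n; exact: measurable_funM.
- by move=> n w; rewrite normrM ler_pM.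
- by move=> w; apply: cvgMl_tmp; exact: cF.
Qed.

End Expectation.

Section SubSigmaAlgebra.
Context (R : realType) (dsp : measure_display) (T : measurableType dsp).
Implicit Types (G : set (set T)) (f : T -> R).

Definition gmeas G f := @bmeas R _ (g_sigma_algebraType G) f.

Lemma gmeas_sub G f : G `<=` measurable -> gmeas G f -> bmeas f.
Proof.
move=> Gm [mf bf]; split => // mT B mB.
exact: (smallest_sub (@sigma_algebra_measurable _ T) Gm) (mf measurableT _ mB).
Qed.

Lemma gmeas_mono G1 G2 f : G1 `<=` G2 -> gmeas G1 f -> gmeas G2 f.
Proof.
move=> G12 [mf bf]; split => // mT B mB.
exact: (sub_smallest2r _ G12) (mf measurableT _ mB).
Qed.

End SubSigmaAlgebra.

Lemma bmeas_indic_le (R : realType) (dsp : measure_display)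
    (T : measurableType dsp) (f : T -> R) (e : R) :
  bmeas f -> bmeas (fun w => (`|f w| <= e)%R%:R : R).
Proof.
move=> [mf _].
have mabs : measurable_fun setT (fun w => `|f w|) by exact: measurableT_comp.
have /(_ measurableT [set true] I) := measurable_fun_ler mabs (measurable_cst e).
rewrite setTI => mA; have := bmeas_indic R mA.
rewrite (_ : \1__ = fun w => (`|f w| <= e)%R%:R :> R)//.
apply/funext => w; rewrite indicE; congr (nat_of_bool _)%:R.
by apply/idP/idP => [|h]; rewrite inE.
Qed.

(** The form of the Cauchy criterion that a maximal bound yields, with a starting index [m] per
    tolerance. Partial sums past [m] are compared through the one at [m], hence half of [e]. *)
Lemma cvg_series_tail (R : realType) (u : nat -> R) :
  (forall j, exists m, forall k, `|\sum_(i < k) u (m + i)%N| <= j.+1%:R^-1) ->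
  cvgn (series u).
Proof.
move=> h; apply/cauchy_cvgP/cauchy_seriesP => e e0.
have [j je] : exists j, j.+1%:R^-1 < e / 2.
  have [N _ hN] := near_infty_natSinv_lt (PosNum (divr_gt0 e0 (ltr0n _ 2))).
  by exists N; apply: (hN N) => /=.
have [m hm] := h j.
exists ([set n | (m <= n)%N], [set n | (m <= n)%N]).
  by split; exists m.
move=> [a b] /= [ma mb].
have part c : (m <= c)%N -> `|series u c - series u m| <= j.+1%:R^-1.
  move=> mc; rewrite sub_series_geq//.
  rewrite -{1}(add0n m) big_addn big_mkord.
  by under eq_bigr do rewrite addnC; exact: hm.
have ab : \sum_(a <= k < b) u k = 0 \/
    \sum_(a <= k < b) u k = series u b - series u a.
  have [ab|/ltnW ba] := leqP a b; first by right; rewrite sub_series_geq.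
  by left; rewrite big_geq.
case: ab => ->; first by rewrite normr0.
rewrite (_ : _ - _ = (series u b - series u m) - (series u a - series u m)); last by ring.
rewrite (le_lt_trans (ler_normB _ _))//.
move: (part a ma) (part b mb) je; set q := _^-1 => ha hb hq; lra.
Qed.

(** * Convergence of square-summable martingale differences *)

Section MartingaleDifferences.
Context (R : realType) (dsp : measure_display) (T : measurableType dsp).
Variable P : probability T R.
Variables (G : nat -> set (set T)) (z : nat -> T -> R).
Hypothesis Gm : forall n, G n `<=` measurable.
Hypothesis GS : forall n, G n `<=` G n.+1.
Hypothesis bz : forall n, gmeas (G n.+1) (z n).
Hypothesis oz : forall n phi, gmeas (G n) phi ->
  \int[P]_w (phi w * z n w) = 0.

(* The partial sums of [z] from index [m] on, stopped when they exceed [e]. *)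
Fixpoint stopped (m : nat) (e : R) (k : nat) (w : T) : R :=
  if k is j.+1 then
    stopped m e j w + (`|stopped m e j w| <= e)%R%:R * z (m + j) w
  else 0.

Lemma gmeas_stopped m e k : gmeas (G (m + k)) (stopped m e k).
Proof.
elim: k => [|k IH]; first exact: bmeas_cst.
have IH' := gmeas_mono (@GS _) IH; rewrite addnS.
by apply: bmeasD => //; apply: bmeasM (bz _); exact: bmeas_indic_le IH'.
Qed.

(** The gate is known before its increment, which kills the cross term, and its square is at most 1.
    With Chebyshev's inequality at the final time this stands in for a maximal inequality, since a
    stopped path keeps its excess. *)
Lemma stopped_second_moment m e n :
  \int[P]_w (stopped m e n w) ^+ 2 <=
  \sum_(k < n) \int[P]_w (z (m + k) w) ^+ 2.
Proof.
elim: n => [|n IH].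
  rewrite big_ord0 (_ : (fun w => _) = fun=> 0) ?exp_cst//.
  by apply/funext => w; rewrite expr0n.
rewrite big_ord_recr /=.
pose M := stopped m e n; pose th w := (`|M w| <= e)%R%:R : R.
have bM := gmeas_stopped m e n; rewrite -/M in bM.
have bth : gmeas (G (m + n)) th by exact: bmeas_indic_le bM.
have bMth : gmeas (G (m + n)) (fun w => M w * th w) by exact: bmeasM.
have bz' : bmeas (z (m + n)) := gmeas_sub (@Gm _) (bz _).
have bM' : bmeas M := gmeas_sub (@Gm _) bM.
have bth' : bmeas th := gmeas_sub (@Gm _) bth.
have -> : (fun w => (M w + th w * z (m + n) w) ^+ 2) =
    (fun w => (M w ^+ 2 + 2 * (M w * th w * z (m + n) w)) +
       th w ^+ 2 * z (m + n) w ^+ 2) by apply/funext => w; ring.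
rewrite !expD; last 4 first.
- exact: bmeas_sqr.
- by apply: bmeasZ; apply: bmeasM => //; exact: bmeasM.
- by apply: bmeasD; [exact: bmeas_sqr|apply: bmeasZ; apply: bmeasM => //; exact: bmeasM].
- by apply: bmeasM; exact: bmeas_sqr.
rewrite expZ; last by apply: bmeasM => //; exact: bmeasM.
rewrite oz// mulr0 addr0; apply: lerD => //; apply: exp_le.
- by apply: bmeasM; exact: bmeas_sqr.
- exact: bmeas_sqr.
- move=> w; have [->|->] : th w = 1 \/ th w = 0.
    by rewrite /th; case: (_ <= _); [left|right].
  + by rewrite expr1n mul1r.
  + by rewrite expr0n mul0r sqr_ge0.
Qed.

(** The path freezes as soon as it exceeds [e]; ending within [e] means that it never froze and
    followed the partial sums throughout. *)
Lemma stopped_partial_sums m e n w : `|stopped m e n w| <= e ->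
  forall k, (k <= n)%N -> `|\sum_(j < k) z (m + j) w| <= e.
Proof.
move=> hn k kn.
suff : forall k, (k <= n)%N ->
    stopped m e k w = \sum_(j < k) z (m + j) w /\ `|stopped m e k w| <= e.
  by move=> /(_ _ kn)[<-].
move=> {k kn}; elim: n hn => [|n IH] hn k.
  by rewrite leqn0 => /eqP ->; rewrite big_ord0.
have Mn : `|stopped m e n w| <= e.
  move: hn => /=; case: (boolP (`|stopped m e n w| <= e)%R) => // /negP hN.
  by rewrite mul0r addr0.
rewrite leq_eqVlt => /predU1P[->|]; last by rewrite ltnS; exact: IH.
split => //; rewrite big_ord_recr /= Mn mul1r.
by have [<- _] := IH Mn n (leqnn n).
Qed.

Lemma stopped_exceeds m e w k : e < `|\sum_(j < k) z (m + j) w| ->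
  forall n, (k <= n)%N -> e < `|stopped m e n w|.
Proof.
move=> h n kn; rewrite ltNge; apply/negP => /stopped_partial_sums/(_ _ kn).
by rewrite leNgt h.
Qed.

Hypothesis bounded_variance :
  exists C : R, forall n, \sum_(k < n) \int[P]_w (z k w) ^+ 2 <= C.

Lemma tail_variance (del : R) : 0 < del ->
  exists m, forall n, \sum_(k < n) \int[P]_w (z (m + k)%N w) ^+ 2 <= del.
Proof.
move=> del0; have [C hC] := bounded_variance.
pose v k := \int[P]_w (z k w) ^+ 2.
have v0 k : 0 <= v k by apply: exp_ge0 => w; exact: sqr_ge0.
have ser n : series v n = \sum_(k < n) v k by rewrite /series /= big_mkord.
have cv : cvgn (series v).
  apply: nondecreasing_is_cvgn.
    by apply: nondecreasing_series => k _ _; exact: v0.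
  by exists C => _ [n _ <-]; rewrite ser; exact: hC.
move/cauchy_cvgP/cauchy_seriesP/(_ _ del0) : cv => [[A B]] /= [[a _ hA] [b _ hB]] h.
set N := maxn a b; exists N => n.
have E : \sum_(N <= k < N + n) v k = \sum_(k < n) v (N + k)%N.
  rewrite -{1}(add0n N) big_addn addKn big_mkord.
  by apply: eq_bigr => k _; rewrite addnC.
have /h /ltW : (A `*` B) (N, N + n)%N.
  split; [apply: hA|apply: hB] => /=; first exact: leq_maxl.
  by rewrite (leq_trans (leq_maxr a b))// leq_addr.
by rewrite /= E ger0_norm//; apply: sumr_ge0 => k _; exact: v0.
Qed.

Lemma martingale_cvg :
  {ae P, forall w, cvgn (series (fun n => z n w))}.
Proof.
have bM m e n : bmeas (stopped m e n) := gmeas_sub (@Gm _) (gmeas_stopped m e n).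
suff H j : {ae P, forall w, exists m, forall k,
    `|\sum_(i < k) z (m + i)%N w| <= j.+1%:R^-1}.
  by apply: filterS (ae_foralln H) => w; exact: cvg_series_tail.
set e : R := j.+1%:R^-1.
have e0 : 0 < e by rewrite invr_gt0.
pose A m n := [set w | e < `|stopped m e n w|]%R.
have mA m n : measurable (A m n).
  have mabs : measurable_fun setT (fun w => `|stopped m e n w|).
    by apply: measurableT_comp => //; case: (bM m e n).
  have /(_ measurableT [set true] I) := measurable_fun_ltr (measurable_cst e) mabs.
  by rewrite setTI.
pose U m := \bigcup_n A m n.
have mU m : measurable (U m) by apply: bigcupT_measurable => n.
(* An excess is never undone, so the events grow with [n] and continuity from below applies. *)
have ndA m : nondecreasing_seq (A m).
  move=> a b ab; apply/subsetPset => w; rewrite /A /= => h.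
  move: ab => /subnKC <-; elim: (b - a)%N => [|c IH]; first by rewrite addn0.
  by rewrite addnS /= leNgt IH mul0r addr0.
have PU m (del : R) : 0 < del ->
    (forall n, \sum_(k < n) \int[P]_w (z (m + k)%N w) ^+ 2 <= del) ->
    (P (U m) <= (del / e ^+ 2)%:E)%E.
  move=> del0 hdel.
  have cU := nondecreasing_cvg_mu (mu := P) (mA m) (mU m) (ndA m).
  rewrite -(cvg_lim _ cU)//; apply: lime_le; first by apply/cvg_ex; eexists; exact: cU.
  apply: nearW => n /=; apply: le_trans (chebyshev_sqr P e0 (bM m e n)) _.
  rewrite lee_fin ler_pM2r ?invr_gt0 ?exprn_gt0//.
  by rewrite (le_trans (stopped_second_moment _ _ _)).
(* A bad point exceeds [e] after every starting index, and [P (U m)] is at most the tail variance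
   over [e ^+ 2]; hence the choice [del * e ^+ 2] below. *)
exists (\bigcap_m U m); split.
- by apply: bigcapT_measurable => m.
- apply/eqP; rewrite eq_le measure_ge0 andbT; apply/lee_addgt0Pr => del del0.
  rewrite add0e.
  have de0 : 0 < del * e ^+ 2 by rewrite mulr_gt0 ?exprn_gt0.
  have [m hm] := tail_variance de0.
  apply: le_trans (_ : (P (U m) <= _)%E).
    by apply: le_measure; rewrite ?inE//; [exact: bigcapT_measurable|exact: bigcap_inf].
  have := PU m _ de0 hm; rewrite mulfK// expf_neq0//; exact: lt0r_neq0.
- move=> w /= h m _; apply: contrapT => hU; apply: h; exists m => k.
  rewrite leNgt; apply/negP => hk; apply: hU; exists k => //.
  exact: (stopped_exceeds hk).
Qed.

End MartingaleDifferences.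

(** * Kronecker's lemma and quantization *)

Lemma cvg_mean (R : realType) (u : nat -> R) (l : R) : u @ \oo --> l ->
  n%:R^-1 * (\sum_(i < n) u i) @[n --> \oo] --> l.
Proof.
move=> /cesaro h; rewrite -cvg_shiftS /=.
apply: cvg_trans h; apply: near_eq_cvg; apply: nearW => n /=.
by rewrite /arithmetic_mean /= /series /= big_mkord.
Qed.

Lemma kronecker (R : realType) (u : nat -> R) :
  cvgn (series (fun n => n.+1%:R^-1 * u n)) ->
  n%:R^-1 * (\sum_(i < n) u i) @[n --> \oo] --> (0 : R).
Proof.
set S := series _ => cS; have [l hl] : exists l : R, S @ \oo --> l by exists (limn S).
have h : (S n - n%:R^-1 * \sum_(i < n) S i) @[n --> \oo] --> (0 : R).
  by rewrite -[X in _ --> X](subrr l); apply: cvgB => //; exact: cvg_mean.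
apply: cvg_trans h; apply: near_eq_cvg; near=> n.
have n0 : n%:R != 0 :> R by rewrite pnatr_eq0 -lt0n; near: n; exists 1.
(* Abel summation: the mean of [u] is [S n] minus the mean of the earlier [S i], and both have the
   same limit. *)
suff E : \sum_(i < n) u i = n%:R * S n - \sum_(i < n) S i.
  by rewrite E mulrBr mulKf.
elim: (n) => [|k IH]; first by rewrite !big_ord0 mul0r subrr.
have SS : S k.+1 = S k + k.+1%:R^-1 * u k by rewrite /S /series /= big_nat_recr.
rewrite !big_ord_recr /= IH SS; have k0 : k.+1%:R != 0 :> R by rewrite pnatr_eq0.
by rewrite mulrDr mulVKf// -{1}natr1; ring.
Unshelve. all: by end_near. Qed.

(** * Approximation on a finite grid *)

Section Quantization.
Variable R : realType.

(** Grid of mesh [n.+1%:R^-1] over the interval from [- n.+1%:R] to [n.+1%:R]: [2 * n.+1] unit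
    lengths of [n.+1] steps each. Values outside are clipped to the end indices, [truncn] sending
    negative numbers to 0. *)
Definition qsize (n : nat) : nat := (2 * n.+1 * n.+1)%N.
Definition qidx (n : nat) (y : R) : 'I_(qsize n).+1 :=
  inord (minn (Num.truncn ((y + n.+1%:R) * n.+1%:R)) (qsize n)).
Definition qval (n : nat) (k : 'I_(qsize n).+1) : R := k%:R / n.+1%:R - n.+1%:R.
Definition qcell (n : nat) (k : 'I_(qsize n).+1) : set R := [set y | qidx n y = k].

Lemma qidxE n y :
  qidx n y = minn (Num.truncn ((y + n.+1%:R) * n.+1%:R)) (qsize n) :> nat.
Proof. by rewrite inordK// ltnS geq_minr. Qed.

Lemma qval_near n (y : R) : `|y| < n.+1%:R -> `|qval (qidx n y) - y| <= n.+1%:R^-1.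
Proof.
rewrite ltr_norml => /andP[yl yu]; set m : R := n.+1%:R.
have m0 : 0 < m by rewrite ltr0n.
have z0 : 0 <= (y + m) * m by rewrite mulr_ge0 ?ltW//; move: yl; rewrite -/m; lra.
have /andP[tl tu] := truncn_itv z0.
have le2 : (Num.truncn ((y + m) * m) <= qsize n)%N.
  rewrite -(ler_nat R) (le_trans tl)// /qsize !natrM -/m ler_pM2r//.
  by move: yu; rewrite -/m; lra.
rewrite /qval qidxE -/m (minn_idPl le2).
move: tl tu; set k := Num.truncn _; rewrite -natr1 => tl tu.
rewrite ler_norml; apply/andP; split.
  have : (y + m) <= (k%:R + 1) / m by rewrite ler_pdivlMr// ltW.
  by rewrite mulrDl mul1r; move: (k%:R / m) (m^-1) => a b; lra.
have : k%:R / m <= y + m by rewrite ler_pdivrMr.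
have : 0 < m^-1 by rewrite invr_gt0.
by move: (k%:R / m) (m^-1) => a b; lra.
Qed.

(** A clipped value stays within [n.+1%:R], hence within the size of [y], and any other moves by at
    most 1. Uniformity in [n] is what bounded convergence requires. *)
Lemma qval_le n (y : R) : `|qval (qidx n y)| <= `|y| + 1.
Proof.
have n1 : n.+1%:R^-1 <= 1 :> R by rewrite invf_le1 ?ltr0n// ler1n.
have [yn|ny] := ltP `|y| n.+1%:R.
  have := ler_normD y (qval (qidx n y) - y); rewrite addrC subrK => /le_trans; apply.
  by rewrite lerD2l (le_trans (qval_near yn)).
apply: le_trans (_ : n.+1%:R <= _); last by rewrite (le_trans ny)// lerDl.
have kn : (qidx n y)%:R / n.+1%:R <= 2 * n.+1%:R :> R.
  by rewrite ler_pdivrMr ?ltr0n// -!natrM ler_nat -ltnS ltn_ord.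
have k0 : 0 <= (qidx n y)%:R / n.+1%:R :> R by rewrite divr_ge0.
by rewrite /qval ler_norml; apply/andP; split; move: kn k0; set a := _ / _; lra.
Qed.

Lemma qval_cvg (y : R) : qval (qidx n y) @[n --> \oo] --> y.
Proof.
apply/cvgrPdist_le => e e0; near=> n.
rewrite distrC (le_trans (qval_near _))//.
  near: n; exists (Num.truncn `|y|) => // n /= hn.
  have := truncnS_gt `|y|; move/lt_le_trans; apply.
  by rewrite ler_nat ltnS.
near: n; have [N _ hN] := near_infty_natSinv_lt (PosNum e0).
by exists N => // n /hN /= /ltW.
Unshelve. all: by end_near. Qed.

Lemma measurable_qcell n k : measurable (qcell (n := n) k).
Proof.
have -> : qcell k = setT `&` (fun y => (qidx n y)%:R : R) @^-1` [set k%:R].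
  rewrite setTI; apply/seteqP; split => [y <-//|y /= /eqP].
  by rewrite eqr_nat => /eqP h; exact: ord_inj h.
apply: (@nondecreasing_measurable R setT) => //.
move=> a b ab; rewrite ler_nat !qidxE leq_min !geq_min leqnn orbT andbT.
by rewrite le_truncn// ler_pM2r ?ltr0n// lerD2r.
Qed.

(** Each point lies in exactly one cell. This is the bridge from independence on boxes to
    independence of functions. *)
Lemma quantize_sum (I : finType) n (F : {ffun I -> 'I_(qsize n).+1} -> R) (y : I -> R) :
  F [ffun i => qidx n (y i)] =
  \sum_(v : {ffun I -> 'I_(qsize n).+1})
     F v * \1_([set y : I -> R | forall i, qcell (v i) (y i)]) y.
Proof.
set v0 := [ffun i => _].
rewrite (bigD1 v0)//= big1 ?addr0 => [|v vv0].
  rewrite indicE mem_set ?mulr1// => i; rewrite /qcell /= /v0 ffunE//.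
rewrite indicE memNset ?mulr0// => h; case/eqP: vv0.
by apply/ffunP => i; rewrite ffunE; rewrite (h i).
Qed.

(** The function is a pointwise limit of finite combinations of indicators of measurable boxes, so
    sequential continuity in the coordinates suffices and no topology on the index space enters. *)
Lemma measurable_seqcont (dsp : measure_display) (T : measurableType dsp)
    (I : finType) (F : (I -> R) -> R) (X : T -> I -> R) :
  (forall (y_ : nat -> I -> R) y, (forall i, y_ n i @[n --> \oo] --> y i) ->
     F (y_ n) @[n --> \oo] --> F y) ->
  (forall i, measurable_fun setT (X ^~ i)) ->
  measurable_fun setT (fun w => F (X w)).
Proof.
move=> cF mX.
pose h n w := F (fun i => qval (qidx n (X w i))).
apply: (@measurable_fun_cvg _ _ _ setT h) => [n|w _]; last first.
  by apply: cF => i; exact: qval_cvg.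
pose F' (v : {ffun I -> 'I_(qsize n).+1}) := F (fun i => qval (v i)).
have -> : h n = fun w => \sum_(v : {ffun I -> 'I_(qsize n).+1})
    F' v * \1_([set y : I -> R | forall i, qcell (v i) (y i)]) (X w).
  apply/funext => w; rewrite -quantize_sum /F' /h; congr F.
  by apply/funext => i; rewrite ffunE.
apply: measurable_sum => v; apply: measurable_funM; first exact: measurable_cst.
have -> : (fun w => \1_([set y : I -> R | forall i, qcell (v i) (y i)]) (X w) : R) =
    \1_(\big[setI/setT]_(i : I) ((X ^~ i) @^-1` qcell (v i))).
  apply/funext => w; rewrite !indicE; congr (nat_of_bool _)%:R.
  rewrite -bigcap_seq.
  apply/idP/idP; rewrite !inE => h' i; first by move=> _; exact: h'.
  by apply: h'; rewrite /= mem_index_enum.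
apply: measurable_indic; apply: big_ind => //; first exact: measurableI.
move=> i _; rewrite -[X in measurable X]setTI; apply: mX => //.
exact: measurable_qcell.
Qed.

End Quantization.

(** * Independence of the past *)

Section Past.
Context (R : realType) (p : nat) (dsp : measure_display) (T : measurableType dsp).
Variables (P : probability T R) (d : nat -> T -> 'cV[R]_p).
Hypothesis iid : iid_vectors P d.

(** A generating pi-system rather than its sigma-algebra, because independence is stated on boxes.
    It involves the data with index below [t] only, so [d t] is the fresh sample. *)
Definition past (t : nat) : set (set T) :=
  [set A | exists B : nat -> 'I_p -> set R, (forall i j, measurable (B i j)) /\
     A = \big[setI/setT]_(i <- iota 0 t) box_event d i (B i)].

Lemma measurable_box t (B : 'I_p -> set R) :
  (forall i, measurable (B i)) -> measurable (box_event d t B).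
Proof.
move=> mB; have [md _ _] := iid.
have -> : box_event d t B =
    \big[setI/setT]_(i : 'I_p) ((fun w => d t w i ord0) @^-1` B i).
  rewrite -bigcap_seq; apply/seteqP; split => w; rewrite /box_event /=.
    by move=> h i _; exact: h.
  by move=> h i; apply: h; rewrite /= mem_index_enum.
apply: big_ind => //; first exact: measurableI.
by move=> i _; rewrite -[X in measurable X]setTI; exact: md.
Qed.

Lemma past_measurable t : past t `<=` measurable.
Proof.
move=> _ [B [mB ->]]; apply: big_ind => //; first exact: measurableI.
by move=> i _; exact: measurable_box.
Qed.

Lemma box_event_setT t : box_event d t (fun=> setT) = setT.
Proof. by apply/seteqP; split. Qed.

Lemma past_mono t : past t `<=` past t.+1.
Proof.
move=> _ [B [mB ->]]; exists (fun i => if i == t then fun=> setT else B i); split.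
  by move=> i j; case: ifP.
rewrite -[t.+1]addn1 iotaD big_cat /= big_seq1 add0n eqxx box_event_setT setIT.
apply: eq_big_seq => i; rewrite mem_iota add0n => /andP[_ it].
by rewrite (ltn_eqF it).
Qed.

Lemma past_setI t : setI_closed (past t).
Proof.
move=> _ _ [B [mB ->]] [B' [mB' ->]].
exists (fun i j => B i j `&` B' i j); split.
  by move=> i j; exact: measurableI.
rewrite -big_split /=; apply: eq_bigr => i _.
by apply/seteqP; split => w; rewrite /box_event /= => h; [
  move=> j; case: h => h1 h2; split |split => j; have [] := h j].
Qed.

Lemma past_setT t : past t setT.
Proof.
exists (fun _ _ => setT); split => //.
by rewrite big1// => i _; exact: box_event_setT.
Qed.

Lemma past_coord t i j : (i < t)%N ->
  measurable_fun (setT : set (g_sigma_algebraType (past t))) (fun w => d i w j 0).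
Proof.
move=> it mT B mB; rewrite setTI; apply: sub_sigma_algebra.
exists (fun i' j' => if (i' == i) && (j' == j) then B else setT); split.
  by move=> i' j'; case: ifP.
rewrite (big_rem i) /=; last by rewrite mem_iota.
rewrite [X in _ `&` X]big1_seq ?setIT.
  apply/seteqP; split => w; rewrite /box_event /=.
    by move=> h j'; rewrite eqxx /=; case: eqP => [->|].
  by move=> /(_ j); rewrite !eqxx.
move=> i' /andP[_]; rewrite mem_rem_uniq ?iota_uniq// inE => /andP[ii' _].
by rewrite (negbTE ii') /= box_event_setT.
Qed.

(** Both sides are finite measures in [A] that agree on the pi-system [past t], hence on what it
    generates. *)
Lemma past_indep t (B : 'I_p -> set R) A : (forall i, measurable (B i)) ->
  <<s past t >> A ->
  fine (P (A `&` box_event d t B)) = fine (P (box_event d t B)) * fine (P A).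
Proof.
move=> mB sA; have mE := measurable_box t mB; set E := box_event d t B.
have [_ ind _] := iid.
pose k : {nonneg R} := NngNum (fine_ge0 (measure_ge0 P E)).
pose m1 := [the measure _ _ of mrestr P mE]; pose m2 := [the measure _ _ of mscale k P].
have : m1 A = m2 A.
  apply: (g_sigma_algebra_measure_unique (past t) _ (fun=> setT)) => //.
  - exact: past_measurable.
  - by move=> _; exact: past_setT.
  - by apply/seteqP; split => // w _; exists 0%N.
  - exact: past_setI.
  - move=> _ [B' [mB' ->]]; rewrite /m1 /m2 /= /mrestr /mscale /=.
    have tU : uniq (t :: iota 0 t) by rewrite /= mem_iota ltnn iota_uniq.
    pose B'' i := if i == t then B else B' i.
    have mB'' i j : measurable (B'' i j) by rewrite /B''; case: ifP.
    have E1 : \big[setI/setT]_(i <- iota 0 t) box_event d i (B'' i) =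
              \big[setI/setT]_(i <- iota 0 t) box_event d i (B' i).
      apply: eq_big_seq => i; rewrite mem_iota add0n => /andP[_ it].
      by rewrite /B'' (ltn_eqF it).
    have := ind _ _ tU mB''; rewrite !big_cons {1 2}/B'' eqxx -/E E1 setIC => ->.
    have /= := ind _ _ (iota_uniq 0 t) mB''; rewrite E1 => ->.
    by rewrite EFinM {1}/B'' eqxx.
  - by move=> _; rewrite /m1 /= /mrestr setTI; apply: le_lt_trans (ltry 1); exact: probability_le1.
rewrite /m1 /m2 /= /mrestr /mscale /= => ->; rewrite fineM//.
by rewrite fin_num_measure//; exact: (smallest_sub (@sigma_algebra_measurable _ T) (@past_measurable t)) sA.
Qed.

Lemma past_indep_fun t (B : 'I_p -> set R) phi : (forall i, measurable (B i)) ->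
  gmeas (past t) phi ->
  \int[P]_w (phi w * \1_(box_event d t B) w) =
  fine (P (box_event d t B)) * \int[P]_w (phi w).
Proof.
move=> mB bphi; have [mphi [C hC]] := bphi; set E := box_event d t B.
have mE : measurable E := measurable_box t mB.
(* The grid in a single coordinate provides simple functions of the past that converge boundedly to
   [phi]. *)
pose I := 'I_1.
pose A n (v : {ffun I -> 'I_(qsize n).+1}) := phi @^-1` qcell (v ord0).
have sA n v : <<s past t >> (A n v).
  have := mphi measurableT _ (measurable_qcell (v ord0)); rewrite setTI; exact.
have sm S : <<s past t >> S -> measurable S.
  exact: (smallest_sub (@sigma_algebra_measurable _ T) (@past_measurable t)).
pose q n w := \sum_(v : {ffun I -> 'I_(qsize n).+1}) qval R (v ord0) * (\1_(A n v) w : R).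
have qE n w : q n w = qval R (qidx n (phi w)).
  transitivity (qval R ([ffun i : I => qidx n (phi w)] ord0)); last by rewrite ffunE.
  rewrite (quantize_sum (fun v : {ffun I -> _} => qval R (v ord0)) (fun=> phi w)).
  apply: eq_bigr => v _; congr (_ * _); rewrite !indicE; congr (nat_of_bool _)%:R.
  apply/idP/idP; rewrite !inE /A /=; last exact.
  by move=> h i; rewrite (ord1 i).
have mq n : measurable_fun setT (q n).
  by apply: measurable_sum => v; apply: measurable_funM => //; apply: measurable_indic; exact: sm.
have qC n w : `|q n w| <= C + 1 by rewrite qE (le_trans (qval_le _ _))// lerD2r.
have cq w : q ^~ w @ \oo --> phi w.
  by under eq_cvg do rewrite qE; exact: qval_cvg.
have bE : bmeas (\1_E : T -> R) by exact: bmeas_indic.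
have bq n : bmeas (q n) by split => //; exists (C + 1).
have c1 := bounded_convergenceM (P := P) (bmeas_cst T (fine (P E))) mq qC cq.
have c2 := bounded_convergenceM (P := P) bE mq qC cq.
have eqn n : \int[P]_w (\1_E w * q n w) = \int[P]_w (fine (P E) * q n w).
  have bA (v : {ffun I -> 'I_(qsize n).+1}) : bmeas (fun w => qval R (v ord0) * (\1_(A n v) w : R)).
    by apply: bmeasZ; apply: bmeas_indic; exact: sm.
  have bAE v : measurable (A n v `&` E) by apply: measurableI => //; exact: sm.
  rewrite expZ// exp_sum// mulr_sumr.
  have -> : (fun w => \1_E w * q n w) = (fun w =>
      \sum_(v : {ffun I -> 'I_(qsize n).+1})
      qval R (v ord0) * (\1_(A n v `&` E) w : R)).
    apply/funext => w; rewrite mulr_sumr; apply: eq_bigr => v _.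
    by rewrite indicI /=; ring.
  rewrite exp_sum => [|v]; last by apply: bmeasZ; exact: bmeas_indic.
  apply: eq_bigr => v _; rewrite !expZ ?exp_indic//; try exact/bmeas_indic/sm.
  - by rewrite past_indep//; ring.
  - exact: sm.
  - exact: bmeas_indic.
rewrite -expZ; last exact: gmeas_sub (@past_measurable _) bphi.
have -> : (fun w => phi w * \1_E w) = (fun w => \1_E w * phi w).
  by apply/funext => w; rewrite mulrC.
apply: cvg_unique c1 => //=; apply: cvg_trans c2.
by apply: near_eq_cvg; apply: nearW => n; rewrite eqn.
Qed.

Lemma past_box t (B : 'I_p -> set R) : (forall i, measurable (B i)) ->
  <<s past t.+1 >> (box_event d t B).
Proof.
move=> mB; apply: sub_sigma_algebra.
exists (fun i => if i == t then B else fun=> setT); split.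
  by move=> i j; case: ifP.
rewrite -[t.+1]addn1 iotaD big_cat /= big_seq1 add0n eqxx big1_seq ?setTI//.
move=> i /andP[_]; rewrite mem_iota add0n => /andP[_ it].
by rewrite (ltn_eqF it) box_event_setT.
Qed.

Definition qvec n (v : {ffun 'I_p -> 'I_(qsize n).+1}) : 'cV[R]_p := \col_i qval R (v i).
Definition dcell s n (v : {ffun 'I_p -> 'I_(qsize n).+1}) :=
  box_event d s (fun i => qcell (v i)).
Definition qdata n (y : 'cV[R]_p) := qvec [ffun i => qidx n (y i 0)].

Lemma measurable_dcell s n v : measurable (dcell s (n := n) v).
Proof. by apply: measurable_box => i; exact: measurable_qcell. Qed.

Lemma dcell_iid s n v : fine (P (dcell s (n := n) v)) = fine (P (dcell 0 v)).
Proof.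
by have [_ _ h] := iid; congr fine; apply: h => i; exact: measurable_qcell.
Qed.

(** * Averaging over a fresh sample *)

Section Compensator.
Variables (M : R) (t : nat) (Psi : T -> 'cV[R]_p -> R).
Hypothesis dM : forall t w i, `|d t w i 0| <= M.
Hypothesis mPsi : forall y,
  measurable_fun (setT : set (g_sigma_algebraType (past t))) (Psi ^~ y).
Hypothesis bPsi : forall K : R, exists C : R, forall w (y : 'cV[R]_p),
  (forall i, `|y i 0| <= K) -> `|Psi w y| <= C.
Hypothesis cPsi : forall w (y_ : nat -> 'cV[R]_p) (y : 'cV[R]_p),
  (forall i, y_ n i 0 @[n --> \oo] --> y i 0) ->
  Psi w (y_ n) @[n --> \oo] --> Psi w y.

(** A version of the conditional expectation of [Psi w (d t w)] given the past: the dependence on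
    [w] is frozen, and [d 0] at the independent variable [w'] only represents the common law. *)
Definition compensator (w : T) : R := \int[P]_w' Psi w (d 0 w').

Let mcell s n v : measurable (dcell s (n := n) v) := measurable_dcell s v.

Let gPsi y : gmeas (past t) (Psi ^~ y).
Proof.
split => //; have [C hC] := bPsi (\sum_i `|y i 0|).
exists C => w; apply: hC => i.
by rewrite (bigD1 i)//= lerDl sumr_ge0.
Qed.

Lemma qdata_sum s n w w' : Psi w (qdata n (d s w')) =
  \sum_(v : {ffun 'I_p -> 'I_(qsize n).+1}) Psi w (qvec v) * \1_(dcell s v) w'.
Proof.
rewrite (quantize_sum (fun v => Psi w (qvec v)) (fun i => d s w' i 0)).
by apply: eq_bigr => v _; congr (_ * _); rewrite !indicE; congr (nat_of_bool _)%:R.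
Qed.

Let qbound : exists C : R, forall s n w w', `|Psi w (qdata n (d s w'))| <= C.
Proof.
have [C hC] := bPsi (M + 1); exists C => s n w w'; apply: hC => i.
by rewrite mxE ffunE (le_trans (qval_le _ _))// lerD2r.
Qed.

Let qcvg s w w' : Psi w (qdata n (d s w')) @[n --> \oo] --> Psi w (d s w').
Proof.
by apply: cPsi => i; under eq_cvg do rewrite mxE ffunE; exact: qval_cvg.
Qed.

(** On the grid the integral is a finite sum of past-measurable functions of [w]; measurability thus
    passes to the limit without a product measure. *)
Let qcompensator n (w : T) : R :=
  \sum_(v : {ffun 'I_p -> 'I_(qsize n).+1}) fine (P (dcell 0 v)) * Psi w (qvec v).

Let mq0 s w n : measurable_fun setT (fun w' => Psi w (qdata n (d s w'))).
Proof.
under eq_fun do rewrite qdata_sum.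
by apply: measurable_sum => v; apply: measurable_funM => //.
Qed.

Let qcompensatorE n w : qcompensator n w = \int[P]_w' Psi w (qdata n (d 0 w')).
Proof.
under eq_Rintegral do rewrite qdata_sum.
rewrite exp_sum => [|v]; last by apply: bmeasZ; exact: bmeas_indic.
apply: eq_bigr => v _; rewrite expZ; last exact: bmeas_indic.
by rewrite exp_indic// mulrC.
Qed.

Let qcompensator_cvg w : qcompensator n w @[n --> \oo] --> compensator w.
Proof.
have [C hC] := qbound.
have [_ h] := bounded_convergence P (mq0 0 w) (fun n => hC 0%N n w) (fun w' => @qcvg 0%N w w').
apply: cvg_trans h; apply: near_eq_cvg; apply: nearW => n.
by rewrite qcompensatorE.
Qed.

Let qcompensator_le : exists C : R, forall n w, `|qcompensator n w| <= C.
Proof.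
have [C hC] := qbound; exists C => n w; rewrite qcompensatorE.
by apply: exp_norm_le => //; split => //; exists C.
Qed.

Let gqcompensator n : gmeas (past t) (qcompensator n).
Proof. by apply: bmeas_sum => v; apply: bmeasZ; exact: gPsi. Qed.

Lemma bmeas_Psi0 w : bmeas (fun w' => Psi w (d 0 w')).
Proof.
split; last by have [C hC] := bPsi M; exists C => w'; apply: hC => i; exact: dM.
by apply: (measurable_fun_cvg (mq0 0 w)) => w' _; exact: qcvg.
Qed.

Lemma compensator_le C : (forall w w', `|Psi w (d 0 w')| <= C) ->
  forall w, `|compensator w| <= C.
Proof.
by move=> hC w; apply: exp_norm_le => //; exact: bmeas_Psi0.
Qed.

Lemma gmeas_compensator : gmeas (past t) compensator.
Proof.
split.
  apply: (@measurable_fun_cvg _ (g_sigma_algebraType (past t)) _ setT qcompensator).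
    by move=> n; exact: (gqcompensator n).1.
  by move=> w _; exact: qcompensator_cvg.
have [C hC] := bPsi M; exists C; apply: compensator_le => w w'.
by apply: hC => i; exact: dM.
Qed.

Lemma gmeas_Psi_data : gmeas (past t.+1) (fun w => Psi w (d t w)).
Proof.
split; last by have [C hC] := bPsi M; exists C => w; apply: hC => i; exact: dM.
apply: (@measurable_fun_cvg _ (g_sigma_algebraType (past t.+1)) _ setT
  (fun n w => Psi w (qdata n (d t w)))); last by move=> w _; exact: qcvg.
move=> n; under eq_fun do rewrite qdata_sum.
apply: measurable_sum => v; apply: measurable_funM.
  exact: (gmeas_mono (@past_mono _) (gPsi _)).1.
apply: measurable_indic; apply: past_box => i; exact: measurable_qcell.
Qed.

(** On the grid [Psi] splits into past functions times cell indicators, which [past_indep_fun]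
    separates term by term; bounded convergence removes the grid on both sides. *)
Lemma compensator_orth phi : gmeas (past t) phi ->
  \int[P]_w (phi w * (Psi w (d t w) - compensator w)) = 0.
Proof.
move=> gphi; have bphi := gmeas_sub (@past_measurable _) gphi.
have [C1 hC1] := qbound; have [C2 hC2] := qcompensator_le.
have c1 := @bounded_convergenceM _ _ _ P phi (fun n w => Psi w (qdata n (d t w)))
  (fun w => Psi w (d t w)) C1 bphi _ (fun n w => hC1 t n w w) (fun w => @qcvg t w w).
have c2 := bounded_convergenceM (P := P) bphi
  (fun n => (gmeas_sub (@past_measurable _) (gqcompensator n)).1) hC2
  (fun w => @qcompensator_cvg w).
have mPt n : measurable_fun setT (fun w => Psi w (qdata n (d t w))).
  under eq_fun do rewrite qdata_sum.
  apply: measurable_sum => v; apply: measurable_funM; last exact: measurable_indic.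
  exact: (gmeas_sub (@past_measurable _) (gPsi _)).1.
have eqn n : \int[P]_w (phi w * Psi w (qdata n (d t w))) =
    \int[P]_w (phi w * qcompensator n w).
  have gv (v : {ffun 'I_p -> 'I_(qsize n).+1}) : gmeas (past t) (fun w => phi w * Psi w (qvec v)).
    by apply: bmeasM => //; exact: gPsi.
  have bv (v : {ffun 'I_p -> 'I_(qsize n).+1}) : bmeas (fun w => phi w * Psi w (qvec v)).
    exact: gmeas_sub (@past_measurable _) (gv v).
  have -> : (fun w => phi w * Psi w (qdata n (d t w))) = (fun w =>
      \sum_(v : {ffun 'I_p -> 'I_(qsize n).+1})
      (phi w * Psi w (qvec v)) * (\1_(dcell t v) w : R)).
    apply/funext => w; rewrite qdata_sum mulr_sumr; apply: eq_bigr => v _.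
    by rewrite mulrA.
  have -> : (fun w => phi w * qcompensator n w) = (fun w =>
      \sum_(v : {ffun 'I_p -> 'I_(qsize n).+1})
      fine (P (dcell 0 v)) * (phi w * Psi w (qvec v))).
    apply/funext => w; rewrite mulr_sumr; apply: eq_bigr => v _.
    by rewrite mulrCA.
  rewrite !exp_sum; last 2 first.
  - by move=> v; exact: bmeasZ.
  - by move=> v; apply: bmeasM => //; exact: bmeas_indic.
  apply: eq_bigr => v _; rewrite expZ// -(dcell_iid t) past_indep_fun// => i.
  exact: measurable_qcell.
have b1 : bmeas (fun w => Psi w (d t w)).
  exact: gmeas_sub (@past_measurable _) gmeas_Psi_data.
have b2 : bmeas compensator.
  exact: gmeas_sub (@past_measurable _) gmeas_compensator.
under eq_Rintegral do rewrite mulrBr.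
rewrite expB; [|exact: bmeasM|exact: bmeasM]; apply/eqP; rewrite subr_eq0; apply/eqP.
apply: cvg_unique c2 => //; apply: cvg_trans (c1 mPt).
by apply: near_eq_cvg; apply: nearW => n; rewrite eqn.
Qed.

End Compensator.

End Past.

(** * Regularized least-squares updates *)

Section RankOneUpdates.
Variables (R : realType) (r : nat) (lam : R) (x : nat -> 'cV[R]_r).
Hypothesis lam_gt0 : 0 < lam.

Lemma dotE n (u v : 'cV[R]_n) : dot u v = (u^T *m v) 0 0.
Proof. by rewrite mxE; apply: eq_bigr => i _; rewrite mxE. Qed.

Lemma trmx_mul_dot n (u v : 'cV[R]_n) : u^T *m v = (dot u v)%:M.
Proof. by apply/matrixP => i j; rewrite !ord1 -dotE !mxE eqxx mulr1n. Qed.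

Lemma outer_mul n m (u : 'cV[R]_m) (v w : 'cV[R]_n) :
  u *m v^T *m w = dot v w *: u.
Proof. by rewrite -mulmxA trmx_mul_dot mul_mx_scalar. Qed.

Lemma dotDr n (u v w : 'cV[R]_n) : dot u (v + w) = dot u v + dot u w.
Proof. by rewrite dotC dotDl dotC (dotC w). Qed.

Lemma dotNr n (u v : 'cV[R]_n) : dot u (- v) = - dot u v.
Proof. by rewrite dotC dotNl dotC. Qed.

Lemma dotZr n a (u v : 'cV[R]_n) : dot u (a *: v) = a * dot u v.
Proof. by rewrite dotC dotZl dotC. Qed.

(* [ridgeQ t] is the inverse of [Amat x t + lam%:M], by Sherman-Morrison. *)
Fixpoint ridgeQ (t : nat) : 'M[R]_r :=
  if t is k.+1 then
    ridgeQ k - (1 + dot (x k) (ridgeQ k *m x k))^-1 *: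
      ((ridgeQ k *m x k) *m (ridgeQ k *m x k)^T)
  else (lam^-1)%:M.

Definition gain (t : nat) : 'cV[R]_r := ridgeQ t *m x t.
Definition leverage (t : nat) : R := dot (x t) (gain t).

Lemma ridgeQS t :
  ridgeQ t.+1 = ridgeQ t - (1 + leverage t)^-1 *: (gain t *m (gain t)^T).
Proof. by []. Qed.

Lemma ridgeQ_sym t : (ridgeQ t)^T = ridgeQ t.
Proof.
elim: t => [|t IH]; first exact: tr_scalar_mx.
by rewrite ridgeQS linearB linearZ /= trmx_mul trmxK IH.
Qed.

Let H t := Amat x t + lam%:M.

Lemma dot_H_ge t y : lam * l2sq y <= dot (H t *m y) y.
Proof.
rewrite mulmxDl mul_scalar_mx dotDl dotZl dotxx lerDr.
rewrite /Amat; elim: t => [|t IH].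
  by rewrite big_ord0 mul0mx /dot big1// => i _; rewrite mxE mul0r.
rewrite big_ord_recr mulmxDl dotDl addr_ge0//= outer_mul dotZl.
by rewrite -expr2 sqr_ge0.
Qed.

(** Kept apart from [ridgeQ_inv] because the inductive step there divides by [1 + leverage t], and
    nonnegativity of the leverage comes from the inverse relation at [t] itself. *)
Lemma ridgeQ_psd_of_inv t : H t *m ridgeQ t = 1%:M ->
  forall z, 0 <= dot z (ridgeQ t *m z).
Proof.
move=> HQ z; have := dot_H_ge t (ridgeQ t *m z).
rewrite mulmxA HQ mul1mx; apply: le_trans.
by rewrite mulr_ge0 ?l2sq_ge0 ?ltW.
Qed.

Lemma ridgeQ_inv t : H t *m ridgeQ t = 1%:M.
Proof.
elim: t => [|t IH].
  by rewrite /H /Amat big_ord0 add0r -scalar_mxM divff// gt_eqF.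
have u0 : 0 <= leverage t by exact: ridgeQ_psd_of_inv.
have u1 : 1 + leverage t != 0 by rewrite gt_eqF// ltr_pwDl.
have -> : H t.+1 = H t + x t *m (x t)^T by rewrite /H /Amat big_ord_recr /= addrAC.
have HG : H t *m gain t = x t by rewrite mulmxA IH mul1mx.
have xQ : (x t)^T *m ridgeQ t = (gain t)^T by rewrite trmx_mul ridgeQ_sym.
have e1 : (H t + x t *m (x t)^T) *m ridgeQ t = 1%:M + x t *m (gain t)^T.
  by rewrite mulmxDl IH -mulmxA xQ.
have e2 : (H t + x t *m (x t)^T) *m (gain t *m (gain t)^T) =
    (1 + leverage t) *: (x t *m (gain t)^T).
  rewrite mulmxA mulmxDl HG outer_mul -/(leverage t) mulmxDl -scalemxAl.
  by rewrite scalerDl scale1r.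
by rewrite ridgeQS mulmxBr -scalemxAr e1 e2 scalerA mulVf// scale1r addrK.
Qed.

Lemma ridgeQ_psd t z : 0 <= dot z (ridgeQ t *m z).
Proof. by apply: ridgeQ_psd_of_inv; exact: ridgeQ_inv. Qed.

Lemma leverage_ge0 t : 0 <= leverage t.
Proof. exact: ridgeQ_psd. Qed.

Lemma ridgeQ_le t z : dot z (ridgeQ t *m z) <= l2sq z / lam.
Proof.
elim: t => [|t IH]; first by rewrite mul_scalar_mx dotZr dotxx mulrC.
apply: le_trans IH; rewrite ridgeQS mulmxBl dotDr dotNr -scalemxAl dotZr.
rewrite outer_mul dotZr (dotC z (gain t)) -expr2 gerBl.
by rewrite mulr_ge0 ?sqr_ge0// invr_ge0 addr_ge0// leverage_ge0.
Qed.

Lemma l2sq_ridgeQ_le t z : l2sq (ridgeQ t *m z) <= l2sq z / lam ^+ 2.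
Proof.
set y := ridgeQ t *m z.
have [->|y0] := eqVneq (l2sq y) 0; first by rewrite divr_ge0 ?l2sq_ge0 ?sqr_ge0.
have yp : 0 < l2sq y by rewrite lt_def y0 l2sq_ge0.
have h : lam * l2sq y <= dot z y.
  by have := dot_H_ge t y; rewrite mulmxA ridgeQ_inv mul1mx.
have h2 : (lam * l2sq y) ^+ 2 <= l2sq z * l2sq y.
  apply: le_trans (dot_sqr_le z y); rewrite ler_pXn2r// nnegrE.
    by rewrite mulr_ge0 ?ltW.
  by apply: le_trans h; rewrite mulr_ge0 ?ltW.
rewrite ler_pdivlMr ?exprn_gt0// -(ler_pM2r yp).
by apply: le_trans h2; rewrite exprMn [l2sq y ^+ 2]expr2; lra.
Qed.

Lemma mxtrace_ridgeQ_ge0 t : 0 <= \tr (ridgeQ t).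
Proof.
apply: sumr_ge0 => i _; have := ridgeQ_psd t (delta_mx i 0).
rewrite dotE trmx_delta mulmxA -rowE -colE !mxE; exact.
Qed.

Lemma mxtrace_outer (v : 'cV[R]_r) : \tr (v *m v^T) = l2sq v.
Proof.
by rewrite /mxtrace; apply: eq_bigr => i _; rewrite mxE big_ord1 mxE expr2.
Qed.

Lemma sum_gain_le (X : R) n : (forall t, l2sq (x t) <= X) ->
  \sum_(t < n) l2sq (gain t) <= (1 + X / lam) * (r%:R / lam).
Proof.
move=> hX.
have lX t : 1 + leverage t <= 1 + X / lam.
  by rewrite lerD2l (le_trans (ridgeQ_le _ _))// ler_pM2r ?invr_gt0.
have tele : \tr (ridgeQ n) = r%:R / lam
    - \sum_(t < n) (1 + leverage t)^-1 * l2sq (gain t).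
  elim: n => [|n IH]; first by rewrite big_ord0 subr0 mxtrace_scalar mulr_natl.
  rewrite big_ord_recr /= -/(leverage n) -/(gain n) opprD addrA -IH.
  by rewrite linearB linearZ /= mxtrace_outer.
have X0 : 0 <= 1 + X / lam.
  by apply: le_trans (lX 0%N); rewrite addr_ge0// leverage_ge0.
apply: le_trans (_ : (1 + X / lam) *
    \sum_(t < n) (1 + leverage t)^-1 * l2sq (gain t) <= _).
  rewrite mulr_sumr; apply: ler_sum => t _.
  have u0 : 0 < 1 + leverage t by rewrite ltr_pwDl ?leverage_ge0.
  rewrite mulrA ler_peMl ?l2sq_ge0// ler_pdivlMr// mul1r; exact: lX.
rewrite ler_wpM2l//; have := mxtrace_ridgeQ_ge0 n; rewrite tele subr_ge0; exact.
Qed.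

Lemma leverage_sqr_le t : leverage t ^+ 2 <= l2sq (x t) * l2sq (gain t).
Proof. exact: dot_sqr_le. Qed.

(** Passing from the old to the new inverse only rescales the gain; this is the source of the
    normalizing factor in the step of [L]. *)
Lemma trmx_mul_ridgeQS t :
  (x t)^T *m ridgeQ t.+1 = (1 + leverage t)^-1 *: (gain t)^T.
Proof.
have u1 : 1 + leverage t != 0 by rewrite gt_eqF// ltr_pwDl ?leverage_ge0.
rewrite ridgeQS mulmxBr -scalemxAr mulmxA trmx_mul_dot mul_scalar_mx scalerA.
rewrite -/(leverage t); have -> : (x t)^T *m ridgeQ t = (gain t)^T.
  by rewrite trmx_mul ridgeQ_sym.
rewrite -{1}[(gain t)^T]scale1r -scalerBl; congr (_ *: _).
by field.
Qed.

End RankOneUpdates.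

(** * The iteration along a single trajectory *)

Section OnlineIteration.
Variables (R : realType) (p r : nat) (G : {set {set 'I_p}}) (lam1 lam2 : R).
Hypotheses (lam1_gt0 : 0 < lam1) (lam2_gt0 : 0 < lam2).
Variables (L0 : 'M[R]_(p, r)) (d : nat -> 'cV[R]_p) (L : nat -> 'M[R]_(p, r)).
Variables (x : nat -> 'cV[R]_r) (s : nat -> 'cV[R]_p).
Hypothesis run : olsd G lam1 lam2 L0 d L x s.

Local Notation Q := (ridgeQ lam1 x).
Local Notation gain := (gain lam1 x).
Local Notation leverage := (leverage lam1 x).
Local Notation lhat := (lhat G lam1 lam2).
Local Notation ell := (ell G lam1 lam2).
Let e t := residual (d t) (L t) (x t) (s t).
Let H t := Amat x t + lam1%:M.

(** Valid from index 1 on: [L 0] is arbitrary while [Bmat] vanishes at 0. Hence the shifted indices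
    in [olsd_step] and the separate [olsd_first]. *)
Lemma olsd_B t : L t.+1 *m H t.+1 = Bmat d x s t.+1.
Proof.
have [_ _ ->] := run; rewrite -/(H t.+1) mulmxKV//.
by have [] := mulmx1_unit (ridgeQ_inv x lam1_gt0 t.+1).
Qed.

Let BS t : Bmat d x s t.+1 = Bmat d x s t + (L t *m x t + e t) *m (x t)^T.
Proof.
rewrite /Bmat big_ord_recr /=; congr (_ + _ *m _); rewrite /e /residual.
by apply/matrixP => i j; rewrite !mxE; ring.
Qed.

Let HS t : H t.+1 = H t + x t *m (x t)^T.
Proof. by rewrite /H /Amat big_ord_recr /= addrAC. Qed.

(** In [d - s = L x + e] the part [L x x^T] turns the old product [L H] into the one with the new
    [H], so only [e x^T] moves the basis. *)
Lemma olsd_step t :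
  L t.+2 = L t.+1 + (1 + leverage t.+1)^-1 *: (e t.+1 *m (gain t.+1)^T).
Proof.
have := olsd_B t.+1; rewrite BS -(olsd_B t) mulmxDl -mulmxA addrA -mulmxDr -HS.
move/(congr1 (fun A => A *m Q t.+2)).
rewrite mulmxDl -!mulmxA ridgeQ_inv// !mulmx1 => ->.
by rewrite trmx_mul_ridgeQS// scalemxAr.
Qed.

Lemma olsd_first : L 1 = (L 0 *m x 0%N + e 0) *m (x 0%N)^T *m Q 1.
Proof.
have := olsd_B 0; rewrite BS /Bmat big_ord0 add0r => /(congr1 (fun A => A *m Q 1)).
by rewrite -!mulmxA ridgeQ_inv// mulmx1 !mulmxA.
Qed.

Definition fdot (A B : 'M[R]_(p, r)) : R := \sum_i \sum_j A i j * B i j.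

Lemma fdotDr A B C : fdot A (B + C) = fdot A B + fdot A C.
Proof.
rewrite -big_split; apply: eq_bigr => i _; rewrite -big_split; apply: eq_bigr => j _.
by rewrite mxE mulrDr.
Qed.

Lemma fdotZr a A B : fdot A (a *: B) = a * fdot A B.
Proof.
rewrite mulr_sumr; apply: eq_bigr => i _; rewrite mulr_sumr; apply: eq_bigr => j _.
by rewrite mxE mulrCA.
Qed.

Lemma dot_fdot (A : 'M[R]_(p, r)) u v : dot u (A *m v) = fdot A (u *m v^T).
Proof.
apply: eq_bigr => i _; rewrite mxE mulr_sumr; apply: eq_bigr => j _.
by rewrite mxE big_ord1 mxE mulrCA.
Qed.

Lemma frob2D (A B : 'M[R]_(p, r)) : frob2 (A + B) = frob2 A + 2 * fdot B A + frob2 B.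
Proof.
rewrite mulr_sumr -!big_split; apply: eq_bigr => i _ /=.
rewrite mulr_sumr -!big_split; apply: eq_bigr => j _ /=.
by rewrite mxE; ring.
Qed.

Lemma frob2_ge0 (A : 'M[R]_(p, r)) : 0 <= frob2 A.
Proof. by apply: sumr_ge0 => i _; apply: sumr_ge0 => j _; exact: sqr_ge0. Qed.

(** This is [t] times the surrogate when [t > 0]. At [t = 0] it retains the ridge term, which
    becomes the constant of the regret bound. *)
Definition cumcost t (L' : 'M[R]_(p, r)) : R :=
  \sum_(i < t) lhat (d i) L' (x i) (s i) + lam1 / 2 * frob2 L'.

Lemma sum_residual t (A : 'M[R]_(p, r)) :
  \sum_(i < t) residual (d i) A (x i) (s i) *m (x i)^T = Bmat d x s t - A *m Amat x t.
Proof.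
rewrite /Bmat /Amat mulmx_sumr -sumrB; apply: eq_bigr => i _.
by rewrite mulmxA -mulmxBl /residual addrAC.
Qed.

Lemma cumcost_min t L' : cumcost t.+1 (L t.+1) <= cumcost t.+1 L'.
Proof.
set A := L t.+1; set Dl := L' - A.
(* The first-order condition: it cancels all terms linear in [Dl], leaving squares. *)
have normal : \sum_(i < t.+1) residual (d i) A (x i) (s i) *m (x i)^T = lam1 *: A.
  rewrite sum_residual -olsd_B -/A /H mulmxDr addrAC subrr add0r.
  by rewrite mul_mx_scalar.
have -> : L' = A + Dl by rewrite addrC subrK.
have E i : lhat (d i) (A + Dl) (x i) (s i) = lhat (d i) A (x i) (s i)
    - fdot Dl (residual (d i) A (x i) (s i) *m (x i)^T) + 2^-1 * l2sq (Dl *m x i).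
  rewrite (lhat_change G lam1 lam2 (d i) (d i) A (A + Dl)) subrr add0r.
  by rewrite -mulNmx opprB !(addrC A Dl) addrK dot_fdot.
rewrite /cumcost frob2D (eq_bigr _ (fun (i : 'I_t.+1) _ => E i)) !big_split /=.
have -> : \sum_(i < t.+1) - fdot Dl (residual (d i) A (x i) (s i) *m (x i)^T) =
    - (lam1 * fdot Dl A).
  rewrite sumrN -fdotZr -normal; congr (- _).
  elim: (t.+1) => [|k IH]; last by rewrite !big_ord_recr /= fdotDr IH.
  by rewrite !big_ord0 /fdot big1// => i _; rewrite big1// => j _; rewrite [X in _ * X]mxE mulr0.
have h1 : 0 <= \sum_(i < t.+1) 2^-1 * l2sq (Dl *m x i).
  by apply: sumr_ge0 => i _; rewrite mulr_ge0 ?l2sq_ge0 ?invr_ge0.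
have h2 : 0 <= lam1 * frob2 Dl by rewrite mulr_ge0 ?frob2_ge0 ?ltW.
by lra.
Qed.

(** The new basis is compared with its predecessor [L t], for which the added term is exactly [ell],
    as [(x t, s t)] was optimal there. *)
Lemma cumcost_le t : cumcost t (L t) <=
  lam1 / 2 * frob2 L0 + \sum_(i < t) ell (d i) (L i).
Proof.
have [L0E hm _] := run.
elim: t => [|t IH]; first by rewrite /cumcost !big_ord0 add0r addr0 L0E.
apply: le_trans (cumcost_min t (L t)) _.
rewrite big_ord_recr /= (ellE lam1_gt0 lam2_gt0 (hm t)) /cumcost big_ord_recr /=.
by move: IH; rewrite /cumcost => IH; lra.
Qed.

Definition gap t : R :=
  surrogate G lam1 lam2 d x s t (L t) - empcost G lam1 lam2 d t (L t).

Lemma gapE t : gap t = t%:R^-1 * (\sum_(i < t) lhat (d i) (L t) (x i) (s i)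
  - \sum_(i < t) ell (d i) (L t)).
Proof. by rewrite /gap /surrogate /empcost; ring. Qed.

Lemma gap_ge0 t : 0 <= gap t.
Proof.
rewrite gapE mulr_ge0 ?invr_ge0// subr_ge0; apply: ler_sum => i _.
exact: ell_le.
Qed.

Lemma gap_le t : gap t <= t%:R^-1 * (lam1 / 2 * frob2 L0) +
  (t%:R^-1 * \sum_(i < t) ell (d i) (L i) - t%:R^-1 * \sum_(i < t) ell (d i) (L t)).
Proof.
rewrite gapE -mulrBr -mulrDr ler_wpM2l ?invr_ge0//.
have := cumcost_le t; rewrite /cumcost.
have h : 0 <= lam1 * frob2 (L t) by rewrite mulr_ge0 ?frob2_ge0 ?ltW.
by move=> h'; lra.
Qed.

(** [ell_change] at an unchanged datum, along the rank-one step. In units of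
    [M2 / lam1 * l2sq (gain t.+1)], the summands [1], [M2] and [M2 ^+ 2] bound the squared leverage,
    the quadratic remainder and the squared first-order term. *)
Lemma ell_descent t y (M2 : R) : (forall i, l2sq (d i) <= M2) -> l2sq y <= M2 ->
  ell y (L t.+2) <= ell y (L t.+1)
    - dot (gain t.+1) (xmin G lam1 lam2 y (L t.+1))
      * dot (rmin G lam1 lam2 y (L t.+1)) (e t.+1)
    + (M2 / lam1 * (1 + M2 + M2 ^+ 2)) * l2sq (gain t.+1).
Proof.
move=> dM yM; have M0 : 0 <= M2 := le_trans (l2sq_ge0 _) yM.
have := ell_change G lam1_gt0 lam2_gt0 y y (L t.+1) (L t.+2).
set x' := xmin _ _ _ _ _; set e' := rmin _ _ _ _ _.
set v := gain t.+1; set u := leverage t.+1; set g := e t.+1.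
have u0 : 0 <= u by exact: leverage_ge0.
have x'M : l2sq x' <= M2 / lam1.
  by rewrite (le_trans (xmin_le _ _ _ _ _))// ler_pM2r ?invr_gt0.
have e'M : l2sq e' <= M2 by rewrite (le_trans (rmin_le _ _ _ _ _)).
have [_ hm _] := run.
have [gM xM] := minimizer_bounds lam1_gt0 lam2_gt0 (hm t.+1).
rewrite -/g in gM; have {}gM := le_trans gM (dM _); have {}xM := le_trans xM (dM _).
have xM' : l2sq (x t.+1) <= M2 / lam1 by rewrite ler_pdivlMr// mulrC.
have -> : y - y - (L t.+1 - L t.+2) *m x' = ((1 + u)^-1 * dot v x') *: g.
  rewrite subrr add0r -mulNmx opprB olsd_step addrAC subrr add0r.
  by rewrite -scalemxAl outer_mul scalerA.
rewrite dotZr l2sqZ; set c := (1 + u)^-1; set a := dot v x'; set b := dot e' g.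
have c0 : 0 <= c by rewrite invr_ge0 addr_ge0.
have c1 : c <= 1 by rewrite invf_le1 ?ltr_pwDl// lerDl.
have cu : 1 - c <= u.
  have : c * (1 + u) = 1 by rewrite mulVf// gt_eqF// ltr_pwDl.
  by nra.
have V0 := l2sq_ge0 v; have X0 := l2sq_ge0 x'; have E0 := l2sq_ge0 e'.
have G0 := l2sq_ge0 g; have Y0 := l2sq_ge0 (x t.+1).
have a2 : a ^+ 2 <= l2sq v * (M2 / lam1).
  by rewrite (le_trans (dot_sqr_le _ _))// ler_wpM2l.
have b2 : b ^+ 2 <= M2 ^+ 2.
  by rewrite (le_trans (dot_sqr_le _ _))// expr2 ler_pM.
have uu : u ^+ 2 <= l2sq v * (M2 / lam1).
  by rewrite (le_trans (leverage_sqr_le _ _ _))// mulrC ler_wpM2l.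
have ab2 : (a * b) ^+ 2 <= l2sq v * (M2 / lam1) * M2 ^+ 2.
  by rewrite exprMn ler_pM ?sqr_ge0.
have ag : a ^+ 2 * l2sq g <= l2sq v * (M2 / lam1) * M2.
  by rewrite ler_pM ?sqr_ge0.
have cag : c ^+ 2 * (a ^+ 2 * l2sq g) <= a ^+ 2 * l2sq g.
  apply: ler_piMl; last exact: exprn_ile1.
  by apply: mulr_ge0 => //; exact: sqr_ge0.
(* The price of replacing [c] by 1, split by the inequality of squares. Without [c] the first-order
   term has a compensator of known sign. *)
have key : (1 - c) * (a * b) <= 2^-1 * (u ^+ 2 + (a * b) ^+ 2).
  have : 0 <= (1 - c - a * b) ^+ 2 by exact: sqr_ge0.
  have : (1 - c) ^+ 2 <= u ^+ 2 by rewrite ler_pXn2r ?nnegrE// subr_ge0.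
  by move=> h1 h2; nra.
have VM0 : 0 <= l2sq v * (M2 / lam1) * (1 + M2 + M2 ^+ 2).
  apply: mulr_ge0; last by rewrite !addr_ge0 ?sqr_ge0.
  by apply: mulr_ge0 => //; exact: divr_ge0 M0 (ltW lam1_gt0).
move=> h.
move: VM0 ab2 ag uu; set W := l2sq v * (M2 / lam1) => VM0 ab2 ag uu.
have -> : M2 / lam1 * (1 + M2 + M2 ^+ 2) * l2sq v = W * (1 + M2 + M2 ^+ 2).
  by rewrite /W; ring.
by lra.
Qed.

End OnlineIteration.

(** * Measurability and almost supermartingales *)

Section MatrixMeasurable.
Context (R : realType) (dsp : measure_display) (T : measurableType dsp).

Definition mmx m n (A : T -> 'M[R]_(m, n)) :=
  forall i j, measurable_fun setT (fun w => A w i j).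

Lemma mmx_cst m n (A : 'M[R]_(m, n)) : mmx (fun=> A).
Proof. by move=> i j; exact: measurable_cst. Qed.

Lemma mmxD m n (A B : T -> 'M[R]_(m, n)) : mmx A -> mmx B -> mmx (fun w => A w + B w).
Proof.
move=> mA mB i j; under eq_fun do rewrite mxE.
exact: measurable_funD.
Qed.

Lemma mmxZ m n (a : T -> R) (A : T -> 'M[R]_(m, n)) :
  measurable_fun setT a -> mmx A -> mmx (fun w => a w *: A w).
Proof.
move=> ma mA i j; under eq_fun do rewrite mxE.
exact: measurable_funM.
Qed.

Lemma mmxN m n (A : T -> 'M[R]_(m, n)) : mmx A -> mmx (fun w => - A w).
Proof.
move=> mA i j; under eq_fun do rewrite mxE.
exact: measurable_funN.
Qed.

Lemma mmxM m n k (A : T -> 'M[R]_(m, n)) (B : T -> 'M[R]_(n, k)) :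
  mmx A -> mmx B -> mmx (fun w => A w *m B w).
Proof.
move=> mA mB i j; under eq_fun do rewrite mxE.
by apply: measurable_sum => l; exact: measurable_funM.
Qed.

Lemma mmx_tr m n (A : T -> 'M[R]_(m, n)) : mmx A -> mmx (fun w => (A w)^T).
Proof. by move=> mA i j; under eq_fun do rewrite mxE; exact: mA. Qed.

Lemma measurable_dot n (u v : T -> 'cV[R]_n) : mmx u -> mmx v ->
  measurable_fun setT (fun w => dot (u w) (v w)).
Proof. by move=> mu mv; apply: measurable_sum => i; exact: measurable_funM. Qed.

(** Inversion is not monotone across 0; after [Num.max 1] it is, at no loss on the values of [a]. *)
Lemma measurable_inv_ge1 (a : T -> R) : measurable_fun setT a ->
  (forall w, 1 <= a w) -> measurable_fun setT (fun w => (a w)^-1).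
Proof.
move=> ma a1.
have -> : (fun w => (a w)^-1) = (fun y : R => (Num.max 1 y)^-1) \o a.
  by apply/funext => w /=; rewrite max_r.
apply: measurableT_comp => //; apply: nonincreasing_measurable => // y z yz.
rewrite lef_pV2 ?posrE ?lt_max ?ltr01//.
by rewrite ge_max !le_max lexx yz orbT.
Qed.

Section Minimizers.
Variables (p r : nat) (G : {set {set 'I_p}}) (lam1 lam2 : R).
Hypotheses (lam1_gt0 : 0 < lam1) (lam2_gt0 : 0 < lam2).
Variables (D : T -> 'cV[R]_p) (L : T -> 'M[R]_(p, r)).
Hypotheses (mD : mmx D) (mL : mmx L).

Lemma measurable_seqcont_mx (F : 'cV[R]_p -> 'M[R]_(p, r) -> R) :
  (forall (d_ : nat -> 'cV[R]_p) (L_ : nat -> 'M[R]_(p, r))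
      (d : 'cV[R]_p) (L : 'M[R]_(p, r)),
     (forall i, d_ n i 0 @[n --> \oo] --> d i 0) ->
     (forall i j, L_ n i j @[n --> \oo] --> L i j) ->
     F (d_ n) (L_ n) @[n --> \oo] --> F d L) ->
  measurable_fun setT (fun w => F (D w) (L w)).
Proof.
move=> cF; pose I : finType := ('I_p + 'I_p * 'I_r)%type.
pose F' (y : I -> R) := F (\col_i y (inl i)) (\matrix_(i, j) y (inr (i, j))).
pose X w (k : I) := match k with inl i => D w i 0 | inr ij => L w ij.1 ij.2 end.
have -> : (fun w => F (D w) (L w)) = fun w => F' (X w).
  apply/funext => w; congr F; apply/matrixP => i j; rewrite mxE//.
  by rewrite (ord1 j).
apply: measurable_seqcont => [y_ y cy|[i|[i j]]]; [|exact: mD|exact: mL].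
apply: cF => [i|i j].
  by rewrite mxE; under eq_cvg do rewrite mxE; exact: cy.
by rewrite mxE; under eq_cvg do rewrite mxE; exact: cy.
Qed.

Lemma mmx_xmin : mmx (fun w => xmin G lam1 lam2 (D w) (L w)).
Proof.
move=> j k; rewrite (ord1 k).
apply: (measurable_seqcont_mx (F := fun d L => xmin G lam1 lam2 d L j 0)).
by move=> d_ L_ d L' cd cL; exact: xmin_cvg.
Qed.

Lemma mmx_rmin : mmx (fun w => rmin G lam1 lam2 (D w) (L w)).
Proof.
move=> i k; rewrite (ord1 k).
apply: (measurable_seqcont_mx (F := fun d L => rmin G lam1 lam2 d L i 0)).
by move=> d_ L_ d L' cd cL; exact: rmin_cvg.
Qed.

Lemma measurable_ell : measurable_fun setT (fun w => ell G lam1 lam2 (D w) (L w)).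
Proof.
apply: (measurable_seqcont_mx (F := fun d L => ell G lam1 lam2 d L)).
by move=> d_ L_ d L' cd cL; exact: ell_cvg.
Qed.

End Minimizers.
End MatrixMeasurable.

Lemma mmx_mono (R : realType) (dsp : measure_display) (T : measurableType dsp)
    (G1 G2 : set (set T)) m n (A : T -> 'M[R]_(m, n)) : G1 `<=` G2 ->
  mmx (A : g_sigma_algebraType G1 -> _) -> mmx (A : g_sigma_algebraType G2 -> _).
Proof.
move=> G12 mA i j mT B mB.
exact: (sub_smallest2r _ G12) (mA i j measurableT _ mB).
Qed.

Lemma sum_inv_sqr_le (R : realType) n : \sum_(k < n) (k.+1%:R^-1 : R) ^+ 2 <= 2.
Proof.
suff h : \sum_(k < n.+1) (k.+1%:R^-1 : R) ^+ 2 <= 2 - n.+1%:R^-1.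
  apply: le_trans (_ : \sum_(k < n.+1) (k.+1%:R^-1 : R) ^+ 2 <= _).
    by rewrite big_ord_recr /= lerDl sqr_ge0.
  by apply: le_trans h _; rewrite gerBl invr_ge0.
elim: n => [|n IH]; first by rewrite big_ord_recr big_ord0 /= invr1 expr1n; lra.
rewrite big_ord_recr /=; apply: le_trans (lerD IH (lexx _)) _.
set a : R := n.+1%:R; have a0 : 0 < a by rewrite ltr0n.
have -> : n.+2%:R = a + 1 :> R by rewrite -natr1.
have -> : (a + 1)^-1 ^+ 2 = (a + 1)^-1 - a / (a + 1) ^+ 2.
  by field; rewrite gt_eqF// ltr_pDr.
rewrite -subr_ge0.
have -> : 2 - (a + 1)^-1 - (2 - a^-1 + ((a + 1)^-1 - a / (a + 1) ^+ 2)) =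
  1 / (a * (a + 1) ^+ 2).
  by field; rewrite !gt_eqF// ltr_pDr.
by rewrite divr_ge0// mulr_ge0 ?sqr_ge0// ltW.
Qed.

(** A pathwise Robbins-Siegmund argument: [U] corrects [f] by both series and is nonincreasing and
    bounded below. The inequality starts at index 1 because the first step of the iteration is
    exceptional. *)
Lemma almost_supermartingale_cvg (R : realType) (f z q : nat -> R) (C : R) :
  (forall n, 0 <= f n) -> (forall n, 0 <= q n) ->
  (forall n, f n.+2 <= f n.+1 - z n.+1 + q n.+1) ->
  cvgn (series z) -> (forall n, \sum_(k < n) q k <= C) -> cvgn f.
Proof.
move=> f0 q0 hf cz qC.
have sq n : series q n <= C by rewrite /series /= big_mkord.
have cq : cvgn (series q).
  apply: nondecreasing_is_cvgn; first by apply: nondecreasing_series.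
  by exists C => _ [n _ <-].
pose U n := f n.+1 + series z n.+1 - series q n.+1.
have [B [_ hB]] := cvg_seq_bounded cz.
have cU : cvgn U.
  apply: nonincreasing_is_cvgn.
    apply/nonincreasing_seqP => n; rewrite /U !seriesSr.
    by have := hf n; lra.
  exists (- (B + 1) - C) => _ [n _ <-]; rewrite /U.
  have : `|series z n.+1| <= B + 1 by apply: (hB (B + 1)) => //; rewrite ltrDl.
  rewrite ler_norml => /andP[h _]; have := f0 n.+1; have := sq n.+1 => h1 h2; lra.
have shift (u : nat -> R) : cvgn u -> cvgn (fun n => u n.+1).
  by move=> cu; apply/cvg_ex; exists (limn u); rewrite (cvg_shiftS u).
have : cvgn (fun n => f n.+1).
  have -> : (fun n => f n.+1) =
      (fun n => U n - series z n.+1 + series q n.+1).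
    by apply/funext => n; rewrite /U; ring.
  apply: is_cvgD; last exact: (shift (series q)).
  by apply: is_cvgB => //; exact: (shift (series z)).
by move=> /cvg_ex[l hl]; apply/cvg_ex; exists l; rewrite -cvg_shiftS.
Qed.

(** * Strong law for bounded martingale differences *)

Section MeanCvg.
Context (R : realType) (dsp : measure_display) (T : measurableType dsp).
Variable P : probability T R.
Variables (G : nat -> set (set T)) (xi : nat -> T -> R) (C : R).
Hypothesis Gm : forall n, G n `<=` measurable.
Hypothesis GS : forall n, G n `<=` G n.+1.
Hypothesis gxi : forall n, gmeas (G n.+1) (xi n).
Hypothesis oxi : forall n phi, gmeas (G n) phi -> \int[P]_w (phi w * xi n w) = 0.
Hypothesis xiC : forall n w, `|xi n w| <= C.

(** Kronecker's lemma reduces the mean to the series with weights [n.+1%:R^-1], whose second moments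
    are at most [C ^+ 2 * n.+1%:R^-1 ^+ 2]. *)
Lemma martingale_mean_cvg :
  {ae P, forall w, n%:R^-1 * (\sum_(i < n) xi i w) @[n --> \oo] --> (0 : R)}.
Proof.
have H : {ae P, forall w, cvgn (series (fun n => n.+1%:R^-1 * xi n w))}.
  apply: (martingale_cvg Gm GS).
  - by move=> n; apply: bmeasZ; exact: gxi.
  - move=> n phi gphi.
    have -> : (fun w => phi w * (n.+1%:R^-1 * xi n w)) =
        (fun w => n.+1%:R^-1 * (phi w * xi n w)).
      by apply/funext => w; rewrite mulrCA.
    rewrite expZ ?oxi ?mulr0//; apply: bmeasM.
      exact: gmeas_sub (@Gm n) gphi.
    exact: gmeas_sub (@Gm n.+1) (gxi n).
  - exists (C ^+ 2 * 2) => n.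
    apply: le_trans (_ : \sum_(k < n) C ^+ 2 * (k.+1%:R^-1) ^+ 2 <= _); last first.
      by rewrite -mulr_sumr ler_wpM2l ?sqr_ge0// sum_inv_sqr_le.
    apply: ler_sum => k _; rewrite -[leRHS](exp_cst P).
    apply: exp_le; last 2 first.
    + exact: bmeas_cst.
    + move=> w; rewrite exprMn mulrC ler_wpM2r ?sqr_ge0//.
      rewrite -real_normK ?num_real// ler_pXn2r ?nnegrE//.
      exact: le_trans (xiC k w).
    + by apply: bmeas_sqr; apply: bmeasZ; exact: gmeas_sub (@Gm k.+1) (gxi k).
by apply: filterS H => w; exact: kronecker.
Qed.

End MeanCvg.

(** * Almost sure convergence *)

Section AlmostSureConvergence.
Context (R : realType) (p r : nat) (G : {set {set 'I_p}}) (lam1 lam2 : R).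
Context (dsp : measure_display) (T : measurableType dsp).
Variables (P : probability T R) (d : nat -> T -> 'cV[R]_p) (M : R).
Variables (L0 : 'M[R]_(p, r)) (L : nat -> T -> 'M[R]_(p, r)).
Variables (x : nat -> T -> 'cV[R]_r) (s : nat -> T -> 'cV[R]_p).
Hypotheses (lam1_gt0 : 0 < lam1) (lam2_gt0 : 0 < lam2).
Hypothesis iid : iid_vectors P d.
Hypothesis dM : forall t w, l2 (d t w) <= M.
Hypothesis run : forall w, olsd G lam1 lam2 L0 (fun t => d t w) (fun t => L t w)
                  (fun t => x t w) (fun t => s t w).

Local Notation ell := (ell G lam1 lam2).
Local Notation xmin := (xmin G lam1 lam2).
Local Notation rmin := (rmin G lam1 lam2).
Local Notation F t := (g_sigma_algebraType (past d t)).
Let M2 := M ^+ 2.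
Let K0 := 1 + M2.
Let Q t w := ridgeQ lam1 (fun k => x k w) t.
Let v t w := gain lam1 (fun k => x k w) t.

Let l2sq_d t w : l2sq (d t w) <= M2.
Proof.
rewrite -(sqr_sqrtr (l2sq_ge0 (d t w))) ler_pXn2r ?nnegrE ?sqrtr_ge0//.
  exact: dM.
by apply: le_trans (dM t w); rewrite sqrtr_ge0.
Qed.

Let M2_ge0 : 0 <= M2. Proof. exact: sqr_ge0. Qed.

Let ML_ge0 : 0 <= M2 / lam1. Proof. exact: divr_ge0 M2_ge0 (ltW lam1_gt0). Qed.

Let dK t w i : `|d t w i 0| <= K0.
Proof. by apply: norm_le_of_sqr; rewrite (le_trans (coord_le_l2sq _ i)). Qed.

Let xE t w : x t w = xmin (d t w) (L t w).
Proof. by have [_ hm _] := run w; have [] := minimizer_xmin lam1_gt0 lam2_gt0 (hm t). Qed.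

Let rE t w : residual (d t w) (L t w) (x t w) (s t w) = rmin (d t w) (L t w).
Proof. by have [_ hm _] := run w; have [] := minimizer_xmin lam1_gt0 lam2_gt0 (hm t). Qed.

Let l2sq_x t w : l2sq (x t w) <= M2 / lam1.
Proof.
by rewrite xE (le_trans (xmin_le _ _ _ _ _))// ler_pM2r ?invr_gt0.
Qed.

(** [Q] joins the induction because the step of [L] contains the gain, and its rank-one recursion
    avoids the measurability of [invmx]. The intermediate [x t] and residual see the datum at [t],
    so they are measured one level higher. *)
Lemma adapted_run t : mmx (L t : F t -> _) /\ mmx (Q t : F t -> _).
Proof.
elim: t => [|t [mL mQ]].
  split; last exact: mmx_cst.
  have -> : L 0 = fun=> L0 by apply/funext => w; have [] := run w.
  exact: mmx_cst.
have {}mL : mmx (L t : F t.+1 -> _) by exact: mmx_mono (@past_mono _ _ _ _ _ _) mL.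
have {}mQ : mmx (Q t : F t.+1 -> _) by exact: mmx_mono (@past_mono _ _ _ _ _ _) mQ.
have md : mmx (d t : F t.+1 -> _) by move=> i j; rewrite (ord1 j); exact: past_coord.
have mx : mmx (x t : F t.+1 -> _).
  have -> : x t = fun w => xmin (d t w) (L t w) by apply/funext => w; exact: xE.
  exact: mmx_xmin.
have me : mmx ((fun w => rmin (d t w) (L t w)) : F t.+1 -> _) by exact: mmx_rmin.
have mv : mmx (v t : F t.+1 -> _) by exact: mmxM.
have mu : measurable_fun (setT : set (F t.+1))
    (fun w => (1 + leverage lam1 (fun k => x k w) t)^-1).
  apply: measurable_inv_ge1 => [|w]; last by rewrite lerDl leverage_ge0.
  by apply: measurable_funD => //; exact: measurable_dot.
have mQS : mmx (Q t.+1 : F t.+1 -> _).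
  by apply: (mmxD mQ (mmxN (mmxZ mu (mmxM mv (mmx_tr mv))))).
split => //; case: t => [|t] in mL mQ md mx me mv mu mQS *.
  have -> : L 1 = fun w => (L 0 w *m x 0%N w + rmin (d 0%N w) (L 0%N w))
      *m (x 0%N w)^T *m Q 1 w.
    by apply/funext => w; rewrite (olsd_first lam1_gt0 (run w)) rE.
  by apply: mmxM mQS; apply: mmxM (mmx_tr mx); apply: mmxD me; exact: mmxM.
have -> : L t.+2 = fun w => L t.+1 w + (1 + leverage lam1 (fun k => x k w) t.+1)^-1 *:
    (rmin (d t.+1 w) (L t.+1 w) *m (v t.+1 w)^T).
  by apply/funext => w; rewrite (olsd_step lam1_gt0 (run w)) rE.
by apply: mmxD mL _; apply: mmxZ mu _; apply: mmxM me _; exact: mmx_tr.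
Qed.

Let mL t : mmx (L t : F t -> _) := (adapted_run t).1.
Let mQ t : mmx (Q t : F t -> _) := (adapted_run t).2.

Let l2sq_coord (y : 'cV[R]_p) (K : R) : (forall i, `|y i 0| <= K) ->
  l2sq y <= p%:R * K ^+ 2.
Proof.
move=> yK; rewrite mulr_natl -[X in _ *+ X]card_ord -sumr_const; apply: ler_sum => i _.
rewrite -real_normK ?num_real// ler_pXn2r ?nnegrE//.
exact: le_trans (yK i).
Qed.

Definition PsiL t (w : T) (y : 'cV[R]_p) : R := ell y (L t w).

Let mPsiL t y : measurable_fun (setT : set (F t)) (PsiL t ^~ y).
Proof. by apply: measurable_ell => //; exact: mmx_cst. Qed.

Let bPsiL t : forall K : R, exists C : R, forall w (y : 'cV[R]_p),
  (forall i, `|y i 0| <= K) -> `|PsiL t w y| <= C.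
Proof.
move=> K; exists (2^-1 * (p%:R * K ^+ 2)) => w y yK.
rewrite ger0_norm ?ell_ge0// (le_trans (ell_le_l2sq _ _ _ _ _))//.
by rewrite ler_pM2l ?invr_gt0// l2sq_coord.
Qed.

Let cPsiL t w (y_ : nat -> 'cV[R]_p) (y : 'cV[R]_p) :
  (forall i, y_ n i 0 @[n --> \oo] --> y i 0) ->
  PsiL t w (y_ n) @[n --> \oo] --> PsiL t w y.
Proof. by move=> cy; apply: ell_cvg => // i j; exact: cvg_cst. Qed.

Definition PsiD t i j (w : T) (y : 'cV[R]_p) : R :=
  rmin y (L t w) i 0 * xmin y (L t w) j 0.

Let mPsiD t i j y : measurable_fun (setT : set (F t)) (PsiD t i j ^~ y).
Proof.
apply: measurable_funM.
  by apply: mmx_rmin => //; exact: mmx_cst.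
by apply: mmx_xmin => //; exact: mmx_cst.
Qed.

Let bPsiD t i j : forall K : R, exists C : R, forall w (y : 'cV[R]_p),
  (forall i, `|y i 0| <= K) -> `|PsiD t i j w y| <= C.
Proof.
move=> K; exists ((1 + p%:R * K ^+ 2) * (1 + p%:R * K ^+ 2 / lam1)) => w y yK.
rewrite normrM ler_pM//; apply: norm_le_of_sqr.
  by rewrite (le_trans (coord_le_l2sq _ i))// (le_trans (rmin_le _ _ _ _ _))// l2sq_coord.
rewrite (le_trans (coord_le_l2sq _ j))// (le_trans (xmin_le _ _ _ _ _))//.
by rewrite ler_pM2r ?invr_gt0// l2sq_coord.
Qed.

Let cPsiD t i j w (y_ : nat -> 'cV[R]_p) (y : 'cV[R]_p) :
  (forall i, y_ n i 0 @[n --> \oo] --> y i 0) ->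
  PsiD t i j w (y_ n) @[n --> \oo] --> PsiD t i j w y.
Proof.
move=> cy; apply: cvgM.
  by apply: rmin_cvg => // k l; exact: cvg_cst.
by apply: xmin_cvg => // k l; exact: cvg_cst.
Qed.

Let bPsiD0 t i j w : bmeas (fun w' => PsiD t i j w (d 0 w')).
Proof. exact: (bmeas_Psi0 iid dK (@bPsiD t i j) (@cPsiD t i j)). Qed.

(* Minus the gradient of the expected loss at [L t w]. *)
Definition Dm t w : 'M[R]_(p, r) := \matrix_(i, j) compensator P d (PsiD t i j) w.

Let mDm t : mmx (Dm t : F t -> _).
Proof.
move=> i j; under eq_fun do rewrite mxE.
exact: (gmeas_compensator iid dK (@mPsiD t i j) (@bPsiD t i j) (@cPsiD t i j)).1.
Qed.

Let bilin_sum t w w' (e : 'cV[R]_p) (g : 'cV[R]_r) :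
  dot g (xmin (d 0 w') (L t w)) * dot (rmin (d 0 w') (L t w)) e =
  \sum_i \sum_j (e i 0 * g j 0) * PsiD t i j w (d 0 w').
Proof.
rewrite mulrC /dot mulr_suml; apply: eq_bigr => i _; rewrite mulr_sumr.
by apply: eq_bigr => j _; rewrite /PsiD; ring.
Qed.

Let bmeas_bilin t w (e : 'cV[R]_p) (g : 'cV[R]_r) :
  bmeas (fun w' => dot g (xmin (d 0 w') (L t w)) * dot (rmin (d 0 w') (L t w)) e).
Proof.
under eq_fun do rewrite bilin_sum.
by apply: bmeas_sum => i; apply: bmeas_sum => j; exact: bmeasZ.
Qed.

Lemma expected_bilin t w (e : 'cV[R]_p) (g : 'cV[R]_r) :
  \int[P]_w' (dot g (xmin (d 0 w') (L t w)) * dot (rmin (d 0 w') (L t w)) e) =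
  dot e (Dm t w *m g).
Proof.
under eq_Rintegral do rewrite bilin_sum.
rewrite exp_sum => [|i]; last by apply: bmeas_sum => j; exact: bmeasZ.
apply: eq_bigr => i _; rewrite exp_sum => [|j]; last exact: bmeasZ.
rewrite mxE mulr_sumr; apply: eq_bigr => j _; rewrite expZ// mxE.
by rewrite /compensator; ring.
Qed.

(** The Cauchy-Schwarz bound holds for each fresh sample and so survives averaging. It is linear in
    [l2sq g]; with the gain for [g] this makes the variances of [zeta] summable. *)
Lemma expected_bilin_sqr_le t w (e : 'cV[R]_p) (g : 'cV[R]_r) :
  dot e (Dm t w *m g) ^+ 2 <= (M2 / lam1 * M2) * (l2sq e * l2sq g).
Proof.
have B0 : 0 <= (M2 / lam1 * M2) * (l2sq e * l2sq g).
  by apply: mulr_ge0; apply: mulr_ge0 => //; exact: l2sq_ge0.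
rewrite -real_normK ?num_real// -[leRHS](sqr_sqrtr B0).
rewrite ler_pXn2r ?nnegrE ?sqrtr_ge0// -expected_bilin.
apply: exp_norm_le => [|w']; first exact: bmeas_bilin.
rewrite -(@ler_pXn2r _ 2) ?nnegrE ?sqrtr_ge0// sqr_sqrtr// real_normK ?num_real//.
rewrite exprMn; set a := dot _ _ ^+ 2; set b := dot _ _ ^+ 2.
have ha : a <= l2sq g * (M2 / lam1).
  rewrite (le_trans (dot_sqr_le _ _))// ler_wpM2l ?l2sq_ge0//.
  by rewrite (le_trans (xmin_le _ _ _ _ _))// ler_pM2r ?invr_gt0.
have hb : b <= M2 * l2sq e.
  rewrite (le_trans (dot_sqr_le _ _))// ler_wpM2r ?l2sq_ge0//.
  by rewrite (le_trans (rmin_le _ _ _ _ _)).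
have -> : M2 / lam1 * M2 * (l2sq e * l2sq g) = l2sq g * (M2 / lam1) * (M2 * l2sq e).
  by ring.
by rewrite ler_pM ?sqr_ge0.
Qed.

(** First-order decrease of the expected loss along the step [e v^T] without its normalizing factor,
    as a function of the datum [y] that produces [e] and [v]. *)
Definition PsiM t (w : T) (y : 'cV[R]_p) : R :=
  dot (rmin y (L t w)) ((Dm t w *m Q t w) *m xmin y (L t w)).

Let mPsiM t y : measurable_fun (setT : set (F t)) (PsiM t ^~ y).
Proof.
apply: measurable_dot; first by apply: mmx_rmin => //; exact: mmx_cst.
apply: mmxM; first exact: mmxM.
by apply: mmx_xmin => //; exact: mmx_cst.
Qed.

Let bPsiM t : forall K : R, exists C : R, forall w (y : 'cV[R]_p),
  (forall i, `|y i 0| <= K) -> `|PsiM t w y| <= C.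
Proof.
move=> K; pose B := p%:R * K ^+ 2.
exists (1 + (M2 / lam1 * M2) * (B * (B / lam1 / lam1 ^+ 2))) => w y yK.
have lB : l2sq y <= B by exact: l2sq_coord.
apply: norm_le_of_sqr; rewrite /PsiM -mulmxA.
apply: le_trans (expected_bilin_sqr_le _ _ _ _) _.
rewrite ler_wpM2l//; first exact: mulr_ge0.
rewrite ler_pM ?l2sq_ge0//; first by rewrite (le_trans (rmin_le _ _ _ _ _)).
rewrite (le_trans (l2sq_ridgeQ_le _ _ _ _))//.
rewrite ler_pM2r ?invr_gt0 ?exprn_gt0// (le_trans (xmin_le _ _ _ _ _))//.
by rewrite ler_pM2r ?invr_gt0.
Qed.

Let cPsiM t w (y_ : nat -> 'cV[R]_p) (y : 'cV[R]_p) :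
  (forall i, y_ n i 0 @[n --> \oo] --> y i 0) ->
  PsiM t w (y_ n) @[n --> \oo] --> PsiM t w y.
Proof.
move=> cy; apply: cvg_sum_fin => i; apply: cvgM.
  by apply: rmin_cvg => // k l; exact: cvg_cst.
rewrite mxE; under eq_cvg do rewrite mxE.
apply: cvg_sum_fin => j; apply: cvgMl_tmp.
by apply: xmin_cvg => // k l; exact: cvg_cst.
Qed.

(** Averaging replaces [e x^T] by [Dm t w]; what remains is the sum of the quadratic forms of the
    positive semidefinite [Q t w] at the rows of [Dm t w]. *)
Lemma compensator_PsiM_ge0 t w : 0 <= compensator P d (PsiM t) w.
Proof.
set A := Dm t w *m Q t w.
have -> : compensator P d (PsiM t) w = \sum_i \sum_j A i j * Dm t w i j.
  rewrite /compensator.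
  have -> : (fun w' => PsiM t w (d 0 w')) = (fun w' =>
      \sum_i \sum_j A i j * PsiD t i j w (d 0 w')).
    apply/funext => w'; rewrite /PsiM -/A; apply: eq_bigr => i _.
    rewrite [(A *m _) i 0]mxE mulr_sumr.
    by apply: eq_bigr => j _; rewrite /PsiD mulrCA.
  rewrite exp_sum => [|i]; last by apply: bmeas_sum => j; exact: bmeasZ.
  apply: eq_bigr => i _; rewrite exp_sum => [|j]; last exact: bmeasZ.
  by apply: eq_bigr => j _; rewrite expZ// [Dm t w i j]mxE.
apply: sumr_ge0 => i _.
have := ridgeQ_psd (fun k => x k w) lam1_gt0 t (row i (Dm t w))^T.
rewrite -/(Q t w) dotC => h; apply: le_trans h _.
rewrite le_eqVlt; apply/orP; left; apply/eqP; apply: eq_bigr => j _.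
rewrite [(row i (Dm t w))^T j 0]mxE [row i (Dm t w) 0 j]mxE; congr (_ * _).
have QT : (Q t w)^T = Q t w by exact: ridgeQ_sym.
by rewrite -QT -trmx_mul [LHS]mxE -row_mul [LHS]mxE.
Qed.

Definition fL t := compensator P d (PsiL t).

Definition zeta t w : R := PsiM t w (d t w) - compensator P d (PsiM t) w.

Let KD := M2 / lam1 * (1 + M2 + M2 ^+ 2).

(** [ell_descent] is averaged over a fresh sample [w'] while the step at [w] stays fixed. The linear
    term becomes [PsiM] at the actual datum, and dropping its nonnegative compensator leaves
    [zeta]. *)
Lemma expected_descent t w :
  fL t.+2 w <= fL t.+1 w - zeta t.+1 w + KD * l2sq (v t.+1 w).
Proof.
pose I w' := dot (v t.+1 w) (xmin (d 0 w') (L t.+1 w)) *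
  dot (rmin (d 0 w') (L t.+1 w)) (rmin (d t.+1 w) (L t.+1 w)).
have bI : bmeas I by exact: bmeas_bilin.
have bL k : bmeas (fun w' => PsiL k w (d 0 w')).
  exact: (bmeas_Psi0 iid dK (@bPsiL k) (@cPsiL k)).
have h : fL t.+2 w <= fL t.+1 w - \int[P]_w' I w' + KD * l2sq (v t.+1 w).
  rewrite /fL /compensator -expB// -(exp_cst P (KD * l2sq _)) -expD; last 2 first.
  - exact: bmeasB.
  - exact: bmeas_cst.
  apply: exp_le => // [|w'].
    by apply: bmeasD; [exact: bmeasB|exact: bmeas_cst].
  have := ell_descent lam1_gt0 lam2_gt0 (run w) t (fun i => l2sq_d i w) (l2sq_d 0 w').
  by rewrite rE.
apply: le_trans h _; rewrite expected_bilin lerD2r lerD2l lerN2.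
have -> : dot (rmin (d t.+1 w) (L t.+1 w)) (Dm t.+1 w *m v t.+1 w) =
    PsiM t.+1 w (d t.+1 w).
  by rewrite /PsiM -mulmxA -xE.
by rewrite /zeta gerBl compensator_PsiM_ge0.
Qed.

Let gPsiM t : gmeas (past d t.+1) (fun w => PsiM t w (d t w)).
Proof. exact: (gmeas_Psi_data dK (@mPsiM t) (@bPsiM t) (@cPsiM t)). Qed.

Let gcPsiM t : gmeas (past d t) (compensator P d (PsiM t)).
Proof. exact: (gmeas_compensator iid dK (@mPsiM t) (@bPsiM t) (@cPsiM t)). Qed.

Let past_m t : past d t `<=` measurable := @past_measurable _ _ _ _ _ _ iid t.
Let past_S t : past d t `<=` past d t.+1 := @past_mono _ _ _ _ _ t.

Let gzeta t : gmeas (past d t.+1) (zeta t).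
Proof. by apply: bmeasB; [exact: gPsiM|exact: gmeas_mono (@past_S t) (gcPsiM t)]. Qed.

Let ozeta t phi : gmeas (past d t) phi -> \int[P]_w (phi w * zeta t w) = 0.
Proof. exact: (compensator_orth iid dK (@mPsiM t) (@bPsiM t) (@cPsiM t)). Qed.

Let sum_v n w : \sum_(t < n) l2sq (v t w) <= (1 + M2 / lam1 / lam1) * (r%:R / lam1).
Proof. by apply: sum_gain_le => // t; exact: l2sq_x. Qed.

Let bmeas_v t : bmeas (fun w => l2sq (v t w)).
Proof.
split; last first.
  exists ((1 + M2 / lam1 / lam1) * (r%:R / lam1)) => w.
  rewrite ger0_norm ?l2sq_ge0//; apply: le_trans (sum_v t.+1 w).
  by rewrite big_ord_recr /= lerDr sumr_ge0// => i _; exact: l2sq_ge0.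
have mT (A : nat) m n (B : T -> 'M[R]_(m, n)) : mmx (B : F A -> _) -> mmx B.
  move=> mB i j _ Y mY.
  exact: (smallest_sub (@sigma_algebra_measurable _ T) (@past_m A)) (mB i j measurableT _ mY).
have mx : mmx (x t).
  have -> : x t = fun w => xmin (d t w) (L t w) by apply/funext => w; exact: xE.
  apply: mmx_xmin => //; last exact: (mT t _ _ _ (@mL t)).
  by apply: (mT t.+1) => i j; rewrite (ord1 j); exact: past_coord.
have mv : mmx (v t) by apply: mmxM => //; exact: (mT t _ _ _ (@mQ t)).
by under eq_fun do rewrite -dotxx; exact: measurable_dot.
Qed.

Lemma zeta_series_cvg : {ae P, forall w, cvgn (series (fun t => zeta t w))}.
Proof.
apply: (martingale_cvg past_m past_S gzeta ozeta).
(* [M2 / lam1 * M2] comes from [expected_bilin_sqr_le], the last [M2] bounds the squared residual.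
   The gains are square-summable on every path, with one constant. *)
pose CV := M2 / lam1 * M2 * M2; have CV0 : 0 <= CV.
  by apply: mulr_ge0 => //; exact: mulr_ge0.
exists (CV * ((1 + M2 / lam1 / lam1) * (r%:R / lam1))) => n.
(* Centering lowers the second moment, as the compensator belongs to the past and is orthogonal to
   [zeta]. *)
have le1 t : \int[P]_w (zeta t w) ^+ 2 <= \int[P]_w (PsiM t w (d t w)) ^+ 2.
  have bz : bmeas (zeta t) := gmeas_sub (@past_m t.+1) (gzeta t).
  have bc : bmeas (compensator P d (PsiM t)) := gmeas_sub (@past_m t) (gcPsiM t).
  have -> : (fun w => PsiM t w (d t w) ^+ 2) = (fun w => (zeta t w ^+ 2 +
      2 * (compensator P d (PsiM t) w * zeta t w)) + compensator P d (PsiM t) w ^+ 2).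
    by apply/funext => w; rewrite /zeta; ring.
  have bcz := bmeasM bc bz.
  rewrite !expD; last 4 first.
  - exact: bmeas_sqr.
  - exact: bmeasZ.
  - by apply: bmeasD; [exact: bmeas_sqr|exact: bmeasZ].
  - exact: bmeas_sqr.
  rewrite expZ// ozeta// mulr0 addr0 lerDl; apply: exp_ge0 => w; exact: sqr_ge0.
apply: le_trans (ler_sum _ (fun (t : 'I_n) _ => le1 t)) _.
apply: le_trans (_ : \sum_(t < n) \int[P]_w (CV * l2sq (v t w)) <= _).
  apply: ler_sum => t _; apply: exp_le.
  - exact/bmeas_sqr/(gmeas_sub (@past_m t.+1) (gPsiM t)).
  - exact: bmeasZ.
  - move=> w; rewrite /PsiM -mulmxA -xE (le_trans (expected_bilin_sqr_le _ _ _ _))//.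
    rewrite /CV -[leRHS]mulrA; apply: ler_wpM2l; first exact: mulr_ge0.
    apply: ler_wpM2r; first exact: l2sq_ge0.
    by rewrite (le_trans (rmin_le _ _ _ _ _)).
rewrite -exp_sum => [|t]; last exact: bmeasZ.
rewrite -[leRHS](exp_cst P); apply: exp_le.
- by apply: bmeas_sum => t; exact: bmeasZ.
- exact: bmeas_cst.
- by move=> w; rewrite -mulr_sumr ler_wpM2l// sum_v.
Qed.

Lemma fL_ge0 t w : 0 <= fL t w.
Proof. by apply: exp_ge0 => w'; exact: ell_ge0. Qed.

Lemma fL_cvg : {ae P, forall w, cvgn (fL ^~ w)}.
Proof.
have KD0 : 0 <= KD by apply: mulr_ge0 => //; rewrite !addr_ge0 ?sqr_ge0.
apply: filterS zeta_series_cvg => w cz.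
apply: (@almost_supermartingale_cvg R _ (fun t => zeta t w) (fun t => KD * l2sq (v t w))
  (KD * ((1 + M2 / lam1 / lam1) * (r%:R / lam1)))) => //.
- by move=> n; exact: fL_ge0.
- by move=> n; rewrite mulr_ge0 ?l2sq_ge0.
- by move=> n; exact: expected_descent.
- by move=> n; rewrite -mulr_sumr ler_wpM2l.
Qed.

Lemma online_loss_mean_cvg : {ae P, forall w,
  n%:R^-1 * (\sum_(i < n) (ell (d i w) (L i w) - fL i w)) @[n --> \oo] --> (0 : R)}.
Proof.
have ell_b y A : l2sq y <= M2 -> `|ell y A| <= M2.
  move=> yM; rewrite ger0_norm ?ell_ge0// (le_trans (ell_le_l2sq _ _ _ _ _))//.
  by have := l2sq_ge0 y; lra.
have fL_b t w : `|fL t w| <= M2.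
  apply: (compensator_le iid dK (@bPsiL t) (@cPsiL t)) => w1 w2.
  exact: ell_b.
apply: (@martingale_mean_cvg R _ _ P (past d)
  (fun i w => ell (d i w) (L i w) - fL i w) (M2 + M2) past_m past_S).
- move=> n; apply: bmeasB.
    exact: (gmeas_Psi_data dK (@mPsiL n) (@bPsiL n) (@cPsiL n)).
  apply: (gmeas_mono (@past_S n)).
  exact: (gmeas_compensator iid dK (@mPsiL n) (@bPsiL n) (@cPsiL n)).
- by move=> n phi; exact: (compensator_orth iid dK (@mPsiL n) (@bPsiL n) (@cPsiL n)).
- by move=> n w; rewrite (le_trans (ler_normB _ _))// lerD// ell_b.
Qed.

(** * Law of large numbers uniform in the basis *)

Let freq n (c : {ffun 'I_p -> 'I_(qsize n).+1}) t w : R :=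
  t%:R^-1 * \sum_(i < t) (\1_(dcell d i c) w - fine (P (dcell d 0 c))).

(** One null set serves all grids and cells, these being countably many, and it does not depend on
    any basis. *)
Lemma cell_frequency_cvg : {ae P, forall w, forall n
  (c : {ffun 'I_p -> 'I_(qsize n).+1}), freq c t w @[t --> \oo] --> (0 : R)}.
Proof.
apply: ae_foralln => n; apply: filter_forall => c.
have mc i : measurable (qcell (R := R) (c i)) by exact: measurable_qcell.
have p1 : `|fine (P (dcell d 0 c))| <= 1.
  rewrite ger0_norm ?fine_ge0// -lee_fin fineK ?probability_le1//.
    exact: (measurable_dcell iid).
  by apply: fin_num_measure; exact: (measurable_dcell iid).
apply: (@martingale_mean_cvg R _ _ P (past d)
  (fun i w => \1_(dcell d i c) w - fine (P (dcell d 0 c))) (1 + 1) past_m past_S).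
- move=> t; apply: bmeasB; last exact: bmeas_cst.
  by apply: bmeas_indic; apply: past_box.
- move=> t phi gphi; have bphi := gmeas_sub (@past_m t) gphi.
  have bi : bmeas (\1_(dcell d t c) : T -> R).
    exact/bmeas_indic/(measurable_dcell iid).
  under eq_Rintegral do rewrite mulrBr.
  rewrite expB; [|exact: bmeasM|by apply: bmeasM => //; exact: bmeas_cst].
  rewrite (past_indep_fun iid mc gphi) -/(dcell d t c) (dcell_iid iid t c).
  have -> : (fun w => phi w * fine (P (dcell d 0 c))) =
      (fun w => fine (P (dcell d 0 c)) * phi w) by apply/funext => w; rewrite mulrC.
  by rewrite expZ// subrr.
- move=> t w; rewrite (le_trans (ler_normB _ _))// lerD//.
  by rewrite indicE; case: (_ \in _); rewrite ?normr1 ?normr0.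
Qed.

(** [B] bounds the squared norm of a datum and of its grid point. In [CL], [1 + B * p%:R] dominates
    the root of [B * p%:R] from the linear term of [ell_change], and the last [p%:R] covers the
    quadratic term. *)
Let B := M2 + p%:R * (K0 + 1) ^+ 2.
Let CL := 1 + B * p%:R + p%:R.

(** Uniform in [A] because the slope [rmin] is bounded by the datum alone; [K0 < n.+1%:R] places all
    data inside the grid. *)
Let ell_quantize n t w (A : 'M[R]_(p, r)) : K0 < n.+1%:R ->
  `|ell (d t w) A - ell (qdata n (d t w)) A| <= CL * n.+1%:R^-1.
Proof.
move=> Kn; set y := d t w; set q := qdata n y; set h : R := n.+1%:R^-1.
have h0 : 0 <= h by rewrite invr_ge0.
have h1 : h <= 1 by rewrite invf_le1 ?ltr0n// ler1n.
have p0 : 0 <= p%:R :> R by [].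
have B0 : 0 <= B by rewrite addr_ge0// mulr_ge0 ?sqr_ge0.
have yB : l2sq y <= B by rewrite (le_trans (l2sq_d _ _))// lerDl mulr_ge0 ?sqr_ge0.
have qB : l2sq q <= B.
  apply: le_trans (_ : p%:R * (K0 + 1) ^+ 2 <= _); last by rewrite lerDr.
  apply: l2sq_coord => i; rewrite mxE ffunE (le_trans (qval_le _ _))//.
  by rewrite lerD2r dK.
have dB : l2sq (y - q) <= p%:R * h ^+ 2.
  apply: l2sq_coord => i; rewrite [X in `|X|]mxE [(- q) i 0]mxE [q i 0]mxE ffunE.
  by rewrite distrC qval_near// (le_lt_trans (dK t w i)).
have bound a b : l2sq a <= B -> l2sq (a - b) <= p%:R * h ^+ 2 ->
    ell b A - ell a A <= CL * h.
  move=> aB abB; have := ell_change G lam1_gt0 lam2_gt0 a b A A.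
  rewrite subrr mul0mx subr0 => H.
  have hd : `|dot (rmin a A) (a - b)| <= (1 + B * p%:R) * h.
    have C0 : 0 <= 1 + B * p%:R by rewrite addr_ge0// mulr_ge0.
    rewrite -(@ler_pXn2r _ 2) ?nnegrE ?mulr_ge0// real_normK ?num_real//.
    apply: le_trans (dot_sqr_le _ _) _.
    apply: le_trans (_ : B * (p%:R * h ^+ 2) <= _).
      rewrite ler_pM ?l2sq_ge0//; exact: le_trans (rmin_le _ _ _ _ _) aB.
    rewrite mulrA exprMn ler_wpM2r ?sqr_ge0//.
    have : 0 <= B * p%:R by rewrite mulr_ge0.
    by move: (B * p%:R) => a' a0; nra.
  have hh : p%:R * h ^+ 2 <= p%:R * h by rewrite ler_wpM2l// expr2 ler_piMr.
  move: hd; rewrite ler_norml => /andP[hd _].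
  have := l2sq_ge0 (a - b); rewrite /CL => H0.
  have -> : (1 + B * p%:R + p%:R) * h = (1 + B * p%:R) * h + p%:R * h by ring.
  by lra.
rewrite ler_norml; apply/andP; split.
  have := bound y q yB dB; lra.
by apply: bound => //; rewrite -l2sqN opprB.
Qed.

(** [L t w] may depend on all the data: on a fixed grid the error is a combination of cell
    frequencies whose coefficients [ell (qvec R c) (L t w)] are bounded independently of the basis,
    so that [rest] dominates it. *)
Lemma uniform_lln w :
  (forall n (c : {ffun 'I_p -> 'I_(qsize n).+1}), freq c t w @[t --> \oo] --> (0 : R)) ->
  (fL t w - t%:R^-1 * \sum_(i < t) ell (d i w) (L t w)) @[t --> \oo] --> (0 : R).
Proof.
move=> hf; apply/cvgrPdist_le => e e0.
have CL0 : 0 <= CL.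
  by rewrite !addr_ge0// mulr_ge0// addr_ge0// mulr_ge0 ?sqr_ge0.
have [n Kn hn] : exists2 n : nat, K0 < n.+1%:R & CL * n.+1%:R^-1 <= e / 3.
  pose n := Num.truncn (K0 + CL * 3 / e).
  have hn : K0 + CL * 3 / e < n.+1%:R by exact: truncnS_gt.
  have c0 : 0 <= CL * 3 / e by rewrite divr_ge0 ?mulr_ge0// ltW.
  have k0 : 0 <= K0 by rewrite addr_ge0.
  exists n; first by apply: le_lt_trans hn; rewrite lerDl.
  rewrite ler_pdivrMr ?ltr0n//.
  have : CL * 3 / e <= n.+1%:R by apply: ltW; apply: le_lt_trans hn; rewrite lerDr.
  by rewrite ler_pdivrMr// => h; lra.
pose rest t := \sum_(c : {ffun 'I_p -> 'I_(qsize n).+1})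
  2^-1 * l2sq (qvec R c) * `|freq c t w|.
have crest : rest t @[t --> \oo] --> (0 : R).
  have E0 : \sum_(c : {ffun 'I_p -> 'I_(qsize n).+1})
      2^-1 * l2sq (qvec R c) * `|0 : R| = 0.
    by rewrite big1// => c _; rewrite normr0 mulr0.
  rewrite -[X in _ --> X]E0.
  apply: cvg_sum_fin => c; apply: cvgMl_tmp; exact: cvg_norm (hf n c).
have e3 : 0 < e / 3 by apply: divr_gt0.
move/cvgrPdist_le/(_ _ e3): crest => crest.
near=> t; rewrite sub0r normrN.
have t0 : t%:R != 0 :> R by rewrite pnatr_eq0 -lt0n; near: t; exists 1%N.
have tp : 0 < t%:R :> R by rewrite lt_def t0 ler0n.
have rest_le : rest t <= e / 3.
  by apply: le_trans (ler_norm _) _; rewrite -normrN -sub0r; near: t.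
pose qmean := \int[P]_w' ell (qdata n (d 0 w')) (L t w).
pose qemp := t%:R^-1 * \sum_(i < t) ell (qdata n (d i w)) (L t w).
pose emp := t%:R^-1 * \sum_(i < t) ell (d i w) (L t w).
rewrite -/emp.
have qs k w' : ell (qdata n (d k w')) (L t w) =
    \sum_(c : {ffun 'I_p -> 'I_(qsize n).+1})
      ell (qvec R c) (L t w) * \1_(dcell d k c) w'.
  exact: (qdata_sum d (PsiL t) k n w w').
have bc (c : {ffun 'I_p -> 'I_(qsize n).+1}) :
    bmeas (fun w' => ell (qvec R c) (L t w) * (\1_(dcell d 0 c) w' : R)).
  by apply: bmeasZ; apply: bmeas_indic; exact: (measurable_dcell iid).
have bq : bmeas (fun w' => ell (qdata n (d 0 w')) (L t w)).
  by under eq_fun do rewrite qs; exact: bmeas_sum.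
have be : bmeas (fun w' => ell (d 0 w') (L t w)).
  exact: (bmeas_Psi0 iid dK (@bPsiL t) (@cPsiL t)).
have h1 : `|fL t w - qmean| <= e / 3.
  rewrite /fL /compensator /qmean /PsiL -expB//; apply: exp_norm_le; first exact: bmeasB.
  by move=> w'; apply: le_trans (ell_quantize _ _ _ Kn) hn.
have h2 : `|qemp - emp| <= e / 3.
  rewrite /qemp /emp -mulrBr -sumrB normrM ger0_norm ?invr_ge0 ?ler0n//.
  rewrite mulrC ler_pdivrMr//; apply: le_trans (ler_norm_sum _ _ _) _.
  apply: le_trans (_ : \sum_(i < t) (e / 3) <= _).
    apply: ler_sum => i _; rewrite distrC.
    by apply: le_trans (ell_quantize _ _ _ Kn) hn.
  by rewrite sumr_const card_ord mulr_natr.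
have h3 : `|qmean - qemp| <= e / 3.
  apply: le_trans rest_le; rewrite distrC.
  have -> : qemp - qmean = \sum_(c : {ffun 'I_p -> 'I_(qsize n).+1})
      ell (qvec R c) (L t w) * freq c t w.
    have -> : qmean = \sum_(c : {ffun 'I_p -> 'I_(qsize n).+1})
        ell (qvec R c) (L t w) * fine (P (dcell d 0 c)).
      rewrite /qmean; under eq_Rintegral do rewrite qs.
      rewrite exp_sum//; apply: eq_bigr => c _.
      have mc0 := measurable_dcell iid 0 c.
      by rewrite expZ ?exp_indic//; exact: bmeas_indic.
    rewrite /qemp (eq_bigr _ (fun (i : 'I_t) _ => qs i w)) exchange_big /=.
    rewrite mulr_sumr -sumrB; apply: eq_bigr => c _.
    rewrite -mulr_sumr /freq sumrB sumr_const card_ord -[_ *+ t]mulr_natr.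
    by field.
  apply: le_trans (ler_norm_sum _ _ _) _; apply: ler_sum => c _.
  rewrite normrM ler_wpM2r// ger0_norm ?ell_ge0//; exact: ell_le_l2sq.
rewrite (_ : _ - _ = (fL t w - qmean) + (qmean - qemp) + (qemp - emp)); last by ring.
rewrite (le_trans (ler_normD _ _))//.
have := ler_normD (fL t w - qmean) (qmean - qemp) => h4.
by lra.
Unshelve. all: by end_near. Qed.

Lemma gap_cvg : {ae P, forall w,
  gap G lam1 lam2 (fun i => d i w) (fun i => L i w) (fun i => x i w)
    (fun i => s i w) t @[t --> \oo] --> (0 : R)}.
Proof.
near=> w.
have c1 : n%:R^-1 * (\sum_(i < n) (ell (d i w) (L i w) - fL i w)) @[n --> \oo] --> (0 : R).
  by near: w; exact: online_loss_mean_cvg.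
have c2 : cvgn (fL ^~ w) by near: w; exact: fL_cvg.
have c3 : (fL t w - t%:R^-1 * \sum_(i < t) ell (d i w) (L t w)) @[t --> \oo] --> (0 : R).
  apply: uniform_lln; near: w; exact: cell_frequency_cvg.
have [l hl] : exists l : R, fL ^~ w @ \oo --> l by exists (limn (fL ^~ w)).
have c4 : (n%:R^-1 * (\sum_(i < n) fL i w) - fL n w) @[n --> \oo] --> (l - l : R).
  exact: cvgB (cvg_mean hl) hl.
have c5 : n%:R^-1 * (lam1 / 2 * frob2 L0) @[n --> \oo] --> (0 * (lam1 / 2 * frob2 L0) : R).
  apply: cvgMr_tmp; rewrite -cvg_shiftS /=; exact: cvg_harmonic.
rewrite subrr in c4; rewrite mul0r in c5.
have up : (t%:R^-1 * (lam1 / 2 * frob2 L0)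
    + t%:R^-1 * (\sum_(i < t) (ell (d i w) (L i w) - fL i w))
    + (t%:R^-1 * (\sum_(i < t) fL i w) - fL t w)
    + (fL t w - t%:R^-1 * \sum_(i < t) ell (d i w) (L t w)))
    @[t --> \oo] --> (0 + 0 + 0 + 0 : R).
  exact: (cvgD (cvgD (cvgD c5 c1) c4) c3).
rewrite !addr0 in up.
apply: (squeeze_cvgr _ (cvg_cst (0 : R)) up); apply: nearW => t; apply/andP; split.
  exact: gap_ge0.
apply: le_trans (gap_le lam1_gt0 lam2_gt0 (run w) t) _.
by rewrite sumrB mulrBr; lra.
Unshelve. all: by end_near. Qed.

End AlmostSureConvergence.

Theorem theorem3 (R : realType) (p r : nat) (lam1 lam2 : R)
  (G : {set {set 'I_p}})
  (dsp : measure_display) (T : measurableType dsp) (P : probability T R)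
  (d : nat -> T -> 'cV[R]_p) (M : R)
  (L0 : 'M[R]_(p, r))
  (L : nat -> T -> 'M[R]_(p, r)) (x : nat -> T -> 'cV[R]_r)
  (s : nat -> T -> 'cV[R]_p) :
  0 < lam1 -> 0 < lam2 -> (0 < p)%N -> (0 < r)%N ->
  iid_vectors P d ->
  (forall t w, l2 (d t w) <= M) ->
  (forall w, olsd G lam1 lam2 L0 (fun t => d t w) (fun t => L t w)
                  (fun t => x t w) (fun t => s t w)) ->
  {ae P, forall w,
     (fun t : nat =>
        surrogate G lam1 lam2 (fun i => d i w) (fun i => x i w) (fun i => s i w) t (L t w)
        - empcost G lam1 lam2 (fun i => d i w) t (L t w)) @ \oo --> (0 : R)}.
Proof. by move=> lam1_gt0 lam2_gt0 _ _ iid dM run; exact: gap_cvg iid dM run. Qed.
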